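(* Let $2\le n<\infty$. (i) Let $m=(n-1)k+1$ with $k\ge 2$ and $\mathcal{W}_m:=\{(w_1,\ldots,w_m)\in(\mathbb{C}^m)_1: |w_m|<1\}$. For $z,y\in\mathcal{W}_m$, $\omega'_z\sim\omega'_y$ if and only if $z=y$. (ii) For $z,y\in\ell^2_1$, $\omega'_z\sim\omega'_y$ if and only if $z=y$.
   Context: For $2\le n<\infty$, $\mathcal{O}_n$ denotes the Cuntz algebra: the universal unital C$^*$-algebra generated by $s_1,\ldots,s_n$ with $s_i^*s_j=\delta_{ij}I$ and $\sum_{i=1}^n s_is_i^*=I$. $(\mathbb{C}^m)_1$ is the set of unit vectors of $\mathbb{C}^m$, and $\ell^2_1$ the set of unit vectors of $\ell^2=\ell^2(\{1,2,\ldots\})$. Convention: $s_n^0=I$. For $m=(n-1)k+1$ with $k\ge2$ and $z\in\mathcal{W}_m$, $\omega'_z$ denotes the geometric progression state of order $k$ by $z$: the unique (and pure) state on $\mathcal{O}_n$ with $\omega'_z(s_n^rs_i)=\overline{z_{(n-1)r+i}}$ for all $r=0,\ldots,k-1$, $i=1,\ldots,n-1$, and $\omega'_z(s_n^k)=\overline{z_m}$. For $z\in\ell^2_1$, $\omega'_z$ denotes the geometric progression state of order $\infty$ by $z$: the unique (and pure) state on $\mathcal{O}_n$ with $\omega'_z(s_n^rs_i)=\overline{z_{(n-1)r+i}}$ for all $r\ge 0$, $i=1,\ldots,n-1$. For states $\omega,\omega'$ on a C$^*$-algebra, $\omega\sim\omega'$ means that their GNS representations are unitarily equivalent. *)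

(* Defs.v *)
From HB Require Import structures.
From mathcomp Require Import all_boot all_order all_algebra.
From mathcomp Require Import all_classical all_reals all_analysis.
From mathcomp Require Import complex.

Set Implicit Arguments.
Unset Strict Implicit.
Unset Printing Implicit Defensive.

Import Order.TTheory GRing.Theory Num.Theory.
Import numFieldNormedType.Exports.

Local Open Scope classical_set_scope.
Local Open Scope ring_scope.

Local Notation normc := ComplexField.Normc.normc.

(* The norm is a field of the structure because MathComp has no join of       *)
(* algebras and normed modules; [GRing.Algebra] excludes the zero algebra.  *)
HB.mixin Record isCStarAlgebra (R : realType) A of GRing.Algebra R[i] A := {
  star : A -> A;
  cnorm : A -> R;
  starK : involutive star;
  starD : forall a b : A, star (a + b) = star a + star b;
  starZ : forall (c : R[i]) (a : A), star (c *: a) = Num.conj c *: star a;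
  starM : forall a b : A, star (a * b) = star b * star a;
  cnorm0_eq0 : forall a : A, cnorm a = 0 -> a = 0;
  ler_cnormD : forall a b : A, cnorm (a + b) <= cnorm a + cnorm b;
  cnormZ : forall (c : R[i]) (a : A), cnorm (c *: a) = normc c * cnorm a;
  ler_cnormM : forall a b : A, cnorm (a * b) <= cnorm a * cnorm b;
  cnorm_starM : forall a : A, cnorm (star a * a) = cnorm a ^+ 2;
  cnorm_complete : forall u : nat -> A,
    (forall e : R, 0 < e -> exists N : nat, forall m p : nat,
      (N <= m)%N -> (N <= p)%N -> cnorm (u m - u p) < e) ->
    exists l : A, cnorm (u m - l) @[m --> \oo] --> (0 : R)
}.

#[short(type="cstarAlgType")]
HB.structure Definition CStarAlgebra (R : realType) :=
  { A of isCStarAlgebra R A & GRing.Algebra R[i] A }.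

(* As for every [{dot _ for _}], the inner product is linear in its first     *)
(* argument and conjugate-linear in its second.                               *)
HB.mixin Record isHilbertSpace (R : realType) H
    of CompleteNormedModule R[i] H := {
  inner : {dot H for @Num.conj R[i]};
  inner_norm : forall x : H, inner x x = `|x| ^+ 2
}.

#[short(type="hilbertType")]
HB.structure Definition HilbertSpace (R : realType) :=
  { H of isHilbertSpace R H & CompleteNormedModule R[i] H }.

Definition cuntz_relations (R : realType) (A : cstarAlgType R) (n : nat)
    (s : 'I_n -> A) : Prop :=
  (forall i j, star (s i) * s j = (i == j)%:R) /\
  \sum_i s i * star (s i) = 1.

Definition norm_closed (R : realType) (A : cstarAlgType R) (S : set A) : Prop :=
  forall (u : nat -> A) (l : A), (forall m, S (u m)) ->
    cnorm (u m - l) @[m --> \oo] --> (0 : R) -> S l.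

Definition generates (R : realType) (A : cstarAlgType R) (n : nat)
    (s : 'I_n -> A) : Prop :=
  forall S : set A, norm_closed S -> GRing.subalg_closed (mem S) ->
    (forall a, S a -> S (star a)) -> (forall i, S (s i)) -> S = setT.

(* The morphism given by the universal property is unique since [s] generates *)
(* [A] and *-homomorphisms are continuous.                                    *)
Definition is_cuntz_algebra (R : realType) (n : nat) (A : cstarAlgType R)
    (s : 'I_n -> A) : Prop :=
  [/\ cuntz_relations s,
      generates s &
      forall (B : cstarAlgType R) (t : 'I_n -> B), cuntz_relations t ->
        exists phi : {lrmorphism A -> B},
          (forall a, phi (star a) = star (phi a)) /\
          (forall i, phi (s i) = t i)].

Definition is_state (R : realType) (A : cstarAlgType R) (w : {scalar A}) : Prop :=
  (forall a, 0 <= w (star a * a)) /\ w 1 = 1.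

Definition is_representation (R : realType) (A : cstarAlgType R)
    (H : hilbertType R) (pi : A -> {linear H -> H}) : Prop :=
  [/\ forall a, continuous (pi a),
      forall (c : R[i]) a b x, pi (c *: a + b) x = c *: pi a x + pi b x,
      forall a b x, pi (a * b) x = pi a (pi b x),
      forall x, pi 1 x = x &
      forall a x y, inner (pi (star a) x) y = inner x (pi a y)].

Definition is_gns (R : realType) (A : cstarAlgType R) (w : {scalar A})
    (H : hilbertType R) (pi : A -> {linear H -> H}) (Omega : H) : Prop :=
  [/\ is_representation pi,
      forall a, w a = inner (pi a Omega) Omega &
      dense (range (fun a => pi a Omega))].

Definition unitarily_equivalent (R : realType) (A : cstarAlgType R)
    (H1 H2 : hilbertType R) (pi1 : A -> {linear H1 -> H1})
    (pi2 : A -> {linear H2 -> H2}) : Prop :=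
  exists U : {linear H1 -> H2},
    [/\ bijective U,
        forall x y, inner (U x) (U y) = inner x y &
        forall a x, U (pi1 a x) = pi2 a (U x)].

(* A GNS triple of a state exists and is unique up to unitary equivalence, so *)
(* the choice of the triples does not matter.                                 *)
Definition state_equiv (R : realType) (A : cstarAlgType R)
    (w1 w2 : {scalar A}) : Prop :=
  exists (H1 : hilbertType R) (pi1 : A -> {linear H1 -> H1}) (Omega1 : H1)
         (H2 : hilbertType R) (pi2 : A -> {linear H2 -> H2}) (Omega2 : H2),
    [/\ is_gns w1 pi1 Omega1, is_gns w2 pi2 Omega2 &
        unitarily_equivalent pi1 pi2].

(* Indices are 0-based: [s i] is s_(i+1), the last generator s_n is           *)
(* [s (last_ord hn)], and the coordinate z_((n-1)r+i) with 1 <= i <= n-1 is   *)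
(* the one of index (n-1)r+i with [i : 'I_n.-1].                              *)
Lemma last_ord_proof (n : nat) : (1 < n)%N -> (n.-1 < n)%N.
Proof. by case: n. Qed.

Definition last_ord (n : nat) (hn : (1 < n)%N) : 'I_n :=
  Ordinal (last_ord_proof hn).

Definition low_ord (n : nat) (i : 'I_n.-1) : 'I_n := widen_ord (leq_pred n) i.

Definition in_W (R : realType) (d : nat) (w : 'rV[R[i]]_d.+1) : Prop :=
  \sum_j `|w 0 j| ^+ 2 = 1 /\ `|w 0 ord_max| < 1.

Definition l2_unit (R : realType) (z : nat -> R[i]) : Prop :=
  series (fun j => normc (z j) ^+ 2) @ \oo --> (1 : R).

Definition is_gp_state (R : realType) (n : nat) (hn : (1 < n)%N)
    (A : cstarAlgType R) (s : 'I_n -> A) (k : nat)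
    (z : 'rV[R[i]]_(n.-1 * k).+1) (w : {scalar A}) : Prop :=
  [/\ is_state w,
      forall (r : 'I_k) (i : 'I_n.-1),
        w (s (last_ord hn) ^+ r * s (low_ord i)) =
          Num.conj (z 0 (inord (n.-1 * r + i))) &
      w (s (last_ord hn) ^+ k) = Num.conj (z 0 ord_max)].

Definition is_gp_state_oo (R : realType) (n : nat) (hn : (1 < n)%N)
    (A : cstarAlgType R) (s : 'I_n -> A) (z : nat -> R[i])
    (w : {scalar A}) : Prop :=
  is_state w /\
  forall (r : nat) (i : 'I_n.-1),
    w (s (last_ord hn) ^+ r * s (low_ord i)) =
      Num.conj (z (n.-1 * r + i)%N).

(* Main.v *)
Require Import Defs.
From HB Require Import structures.
From mathcomp Require Import all_boot all_order all_algebra.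
From mathcomp Require Import all_classical all_reals all_analysis.
From mathcomp Require Import complex.
From mathcomp Require Import ring lra.

Set Implicit Arguments.
Unset Strict Implicit.
Unset Printing Implicit Defensive.
Import Order.TTheory GRing.Theory Num.Theory.
Import numFieldNormedType.Exports.
Local Open Scope classical_set_scope.
Local Open Scope ring_scope.

(** Let t be the last generator and v_(r,i) = t^r l_i for the other generators l_i. For every N, the
    projections v star(v) with r < N and t^N star(t^N) sum to 1 ([progression_sum]). If a state w
    has w(v) = conj z, Cauchy-Schwarz gives w(v star(v)) >= |z|^2. When the |z|^2 sum to 1 there is
    no slack left: star(v) acts on the cyclic vector as the scalar z ([progression_eigen],
    [gns_eigen]), and w(t^N star(t^N)) tends to 0 ([progression_tail]).

    By [progression_vanish], a bounded functional obeying relations of this kind is zero once it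
    vanishes at 1. For the difference of two states with the same z this yields equality
    ([progression_state_unique]). Equivalence then requires an actual GNS triple, so the GNS
    construction is carried out ([gns_rep_cyclic]); its boundedness rests on square roots in a
    C*-algebra ([state_mul_le]).

    If U intertwines the GNS representations for z and y, the matrix coefficient [transition]
    satisfies the relations too. Its value at 1, multiplied by 1 - sum z conj(y), tends to 0, and
    that factor stays away from 0 when z differs from y ([transition1]). So the coefficient is zero,
    which is impossible for cyclic vectors and a surjective U. [progression_state_equiv] combines
    both directions. A state of finite order is reduced to infinite order by [unroll_state],
    [unroll_unit] and [unroll_inj]. *)

Local Notation normc := ComplexField.Normc.normc.
Local Notation Re := complex.Re.
Local Notation Im := complex.Im.

(* Write [t] for the last generator and [l_i] for the others.  If a state [w] *)
(* takes the values [conj z_(r,i)] at the isometries [v = t^r l_i], whose     *)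
(* range projections sum to at most 1, then [sum |z_(r,i)|^2 = 1] forces the  *)
(* equality case of Cauchy-Schwarz: [pi(v)^* Omega = z_(r,i) Omega].  A state *)
(* of finite order is of infinite order for the coordinates [z_m^q z_(r,i)],  *)
(* because [|z_m| < 1], so only infinite order matters.                       *)
(*   A bounded functional [phi] with [phi(a v^* ) = z phi(a)],                *)
(* [phi(v a) = conj y phi(a)], [phi(t^p t^q^* ) -> 0] and [phi(1) = 0] is     *)
(* zero: it vanishes on the words [s_J s_K^*].  With [phi = w - w'] this      *)
(* shows that [z] determines the state, whence [z = y] implies equivalence.   *)
(* With [phi(a) = <U pi_z(a) Omega_z, Omega_y>] for an intertwiner [U] and    *)
(* [z <> y], where [(1 - sum z conj y) phi(1) = 0] gives [phi(1) = 0], it     *)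
(* shows that the cyclic vector [Omega_y] is zero.                            *)

Section Complex.
Variable R : realType.
Implicit Types (x y z : R[i]).

Lemma normr_normc x : `|x| = (normc x)%:C%C.
Proof. by []. Qed.

Lemma normc_ge0 x : 0 <= normc x.
Proof. by rewrite -lecR -normr_normc normr_ge0. Qed.

Lemma normc_conj x : normc (Num.conj x) = normc x.
Proof. by apply: complexI; rewrite -!normr_normc norm_conjC. Qed.

Lemma ler_normcD x y : normc (x + y) <= normc x + normc y.
Proof. by rewrite -lecR rmorphD/= -!normr_normc ler_normD. Qed.

Lemma normcB x y : normc (x - y) = normc (y - x).
Proof. by apply: complexI; rewrite -!normr_normc distrC. Qed.

Lemma normc_opp x : normc (- x) = normc x.
Proof. by apply: complexI; rewrite -!normr_normc normrN. Qed.

Lemma normc_mul x y : normc (x * y) = normc x * normc y.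
Proof. exact: ComplexField.Normc.normcM. Qed.

Lemma normc_real (a : R) : normc a%:C%C = `|a|.
Proof. by rewrite /= expr0n addr0 sqrtr_sqr. Qed.

Lemma mul_conj_normc x : x * Num.conj x = ((normc x) ^+ 2)%:C%C.
Proof. by rewrite -normCK normr_normc rmorphXn. Qed.

Lemma ler_Re_normc x : `|Re x| <= normc x.
Proof. by rewrite -lecR -normr_normc normc_ge_Re. Qed.

Lemma conjCD x y : Num.conj (x + y) = Num.conj x + Num.conj y.
Proof. exact: rmorphD. Qed.

Lemma conjCB x y : Num.conj (x - y) = Num.conj x - Num.conj y.
Proof. exact: rmorphB. Qed.

Lemma conjCM x y : Num.conj (x * y) = Num.conj x * Num.conj y.
Proof. exact: rmorphM. Qed.

Lemma conjC_real (a : R) : Num.conj a%:C%C = a%:C%C.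
Proof. by apply: conj_Creal; rewrite complex_real. Qed.

Lemma complexRe_conj x : Re (Num.conj x) = Re x.
Proof. by case: x. Qed.

Lemma ReD x y : Re (x + y) = Re x + Re y.
Proof. by case: x y => [? ?] [? ?]. Qed.

Lemma ImD x y : Im (x + y) = Im x + Im y.
Proof. by case: x y => [? ?] [? ?]. Qed.

Lemma Re_realM (a : R) x : Re (a%:C%C * x) = a * Re x.
Proof. by case: x => ? ? /=; rewrite mul0r subr0. Qed.

Lemma complex_ge0 x : 0 <= x -> x = (Re x)%:C%C.
Proof. by case: x => a b; rewrite lecE /= => /andP[/eqP ->]. Qed.

Lemma Re_ge0 x : 0 <= x -> 0 <= Re x.
Proof. by rewrite lecE => /andP[]. Qed.

Lemma normc_small_eq0 x : (forall e : R, 0 < e -> normc x <= e) -> x = 0.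
Proof.
move=> h; apply: ComplexField.Normc.eq0_normc; apply: le_anti.
by rewrite normc_ge0 andbT; apply/ler_addgt0Pr => e e0; rewrite add0r h.
Qed.

Lemma normc_le0_eq0 x : normc x <= 0 -> x = 0.
Proof. by move=> h; apply: normc_small_eq0 => e /ltW; exact: le_trans. Qed.

End Complex.

(** * Limits of complex sequences *)

Section ComplexLimit.
Variable R : realType.
Implicit Types (u v : nat -> R[i]) (l : R[i]).

Definition cconverges u l := forall e : R, 0 < e ->
  exists N : nat, forall n, (N <= n)%N -> normc (u n - l) <= e.

Lemma cconverges_unique u l l' : cconverges u l -> cconverges u l' -> l = l'.
Proof.
move=> hl hl'; apply/eqP; rewrite -subr_eq0; apply/eqP/normc_small_eq0 => e e0.
have [N hN] := hl (e / 2) ltac:(lra); have [M hM] := hl' (e / 2) ltac:(lra).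
have := hN _ (leq_maxl N M); have := hM _ (leq_maxr N M).
set n := maxn N M => h1 h2.
have -> : l - l' = (l - u n) + (u n - l') by ring.
by rewrite (le_trans (ler_normcD _ _))// normcB; lra.
Qed.

Lemma cconverges_linear c u v l l' : cconverges u l -> cconverges v l' ->
  cconverges (fun n => c * u n + v n) (c * l + l').
Proof.
move=> hl hl' e e0.
have c0 := normc_ge0 c.
have [N hN] := hl (e / 2 / (normc c + 1)) ltac:(by rewrite !divr_gt0//; lra).
have [M hM] := hl' (e / 2) ltac:(lra).
exists (maxn N M) => n; rewrite geq_max => /andP[/hN h1 /hM h2].
have -> : c * u n + v n - (c * l + l') = c * (u n - l) + (v n - l') by ring.
rewrite (le_trans (ler_normcD _ _))// normc_mul.
have : normc c * normc (u n - l) <= e / 2.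
  rewrite (le_trans (ler_wpM2l c0 h1))// mulrCA ler_piMr//; first by lra.
  by rewrite ler_pdivrMr; lra.
lra.
Qed.

Lemma cconverges_le u l (M : R) :
  cconverges u l -> (exists N : nat, forall n, (N <= n)%N -> normc (u n) <= M) ->
  normc l <= M.
Proof.
move=> hl [N' hN']; apply/ler_addgt0Pr => e /hl [N hN].
have := hN _ (leq_maxl N N'); have := hN' _ (leq_maxr N N').
set n := maxn N N' => h1 h2.
have -> : l = (l - u n) + u n by ring.
by rewrite (le_trans (ler_normcD _ _))// normcB; lra.
Qed.

Lemma real_cauchy_limit (u : nat -> R) :
  (forall e, 0 < e -> exists N : nat, forall m n, (N <= m)%N -> (N <= n)%N ->
     `|u m - u n| <= e) ->
  exists a, forall e, 0 < e -> exists N : nat, forall n, (N <= n)%N ->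
    `|u n - a| <= e.
Proof.
move=> hu; have : cvg (u @ \oo).
  apply: cauchy_cvg; apply/cauchy_ballP => e e0.
  have [N hN] := hu (e / 2) ltac:(lra).
  exists ([set x | exists2 n, (N <= n)%N & x = u n],
          [set x | exists2 n, (N <= n)%N & x = u n]).
    by split; exists N => //= n; exists n.
  move=> [_ _] /= [[m Nm ->] [n Nn ->]].
  by apply: (@le_lt_trans _ _ (e / 2)); [exact: hN | lra].
move/cvg_ex => [a /cvgrPdist_le ha]; exists a => e /ha [N _ hN].
by exists N => n /hN /=; rewrite distrC.
Qed.

Lemma ler_normc_ReIm (x : R[i]) : normc x <= `|Re x| + `|Im x|.
Proof.
rewrite {1}(complexE x) (le_trans (ler_normcD _ _))// normc_real normc_mul.
by rewrite normc_real /= expr0n/= expr1n add0r sqrtr1 mul1r.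
Qed.

Lemma ler_Im_normc (x : R[i]) : `|Im x| <= normc x.
Proof.
by case: x => a b /=; rewrite -sqrtr_sqr ler_wsqrtr// lerDr sqr_ge0.
Qed.

(** Real and imaginary parts are Cauchy because the modulus dominates both. *)
Lemma complex_cauchy_limit u :
  (forall e : R, 0 < e -> exists N : nat, forall m n, (N <= m)%N -> (N <= n)%N ->
     normc (u m - u n) <= e) ->
  exists l, cconverges u l.
Proof.
move=> hu.
have [|a ha] := @real_cauchy_limit (fun n => Re (u n)).
  move=> e /hu [N hN]; exists N => m n Nm Nn; apply: le_trans (hN _ _ Nm Nn).
  by rewrite (le_trans _ (ler_Re_normc _))// raddfB.
have [|b hb] := @real_cauchy_limit (fun n => Im (u n)).
  move=> e /hu [N hN]; exists N => m n Nm Nn; apply: le_trans (hN _ _ Nm Nn).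
  by rewrite (le_trans _ (ler_Im_normc _))// raddfB.
exists (a +i* b)%C => e e0.
have [N hN] := ha (e / 2) ltac:(lra); have [M hM] := hb (e / 2) ltac:(lra).
exists (maxn N M) => n; rewrite geq_max => /andP[/hN h1 /hM h2].
rewrite (le_trans (ler_normc_ReIm _))//.
by case: (u n) h1 h2 => x y /=; lra.
Qed.

End ComplexLimit.

(** * Positive semidefinite forms and the Cauchy-Schwarz inequality *)

Record psd_form (R : realType) (V : lmodType R[i]) := PsdForm {
  form_fun :> V -> V -> R[i];
  form_linear : forall c u v w,
    form_fun (c *: u + v) w = c * form_fun u w + form_fun v w;
  form_conj : forall u v, form_fun v u = Num.conj (form_fun u v);
  form_ge0 : forall u, 0 <= form_fun u u
}.

Section PsdForm.
Variables (R : realType) (V : lmodType R[i]) (B : psd_form V).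
Implicit Types (u v w : V) (c : R[i]).

Lemma form0l u : B 0 u = 0.
Proof.
have := form_linear B 1 0 0 u; rewrite scaler0 addr0 mul1r => /eqP.
by rewrite -subr_eq0 opprD addNKr oppr_eq0 => /eqP.
Qed.

Lemma formDl u v w : B (u + v) w = B u w + B v w.
Proof. by rewrite -{1}(scale1r u) form_linear mul1r. Qed.

Lemma formZl c u w : B (c *: u) w = c * B u w.
Proof. by rewrite -{1}(addr0 (c *: u)) form_linear form0l addr0. Qed.

Lemma formNl u w : B (- u) w = - B u w.
Proof. by rewrite -scaleN1r formZl mulN1r. Qed.

Lemma formBl u v w : B (u - v) w = B u w - B v w.
Proof. by rewrite formDl formNl. Qed.

Lemma formDr u v w : B w (u + v) = B w u + B w v.
Proof. by rewrite form_conj formDl conjCD -!form_conj. Qed.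

Lemma formZr c u w : B w (c *: u) = Num.conj c * B w u.
Proof. by rewrite form_conj formZl conjCM -!form_conj. Qed.

Lemma formBr u v w : B w (u - v) = B w u - B w v.
Proof. by rewrite form_conj formBl conjCB -!form_conj. Qed.

Definition seminorm u : R := Num.sqrt (Re (B u u)).

Lemma seminorm_ge0 u : 0 <= seminorm u.
Proof. exact: sqrtr_ge0. Qed.

Lemma sqr_seminorm u : seminorm u ^+ 2 = Re (B u u).
Proof. by rewrite sqr_sqrtr// Re_ge0// form_ge0. Qed.

Lemma form_seminorm u : B u u = (seminorm u ^+ 2)%:C%C.
Proof. by rewrite sqr_seminorm -complex_ge0// form_ge0. Qed.

Lemma sqr_normc_form_le u v : normc (B u v) ^+ 2 <= Re (B u u) * Re (B v v).
Proof.
set b := normc _ ^+ 2.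
have b0 : 0 <= b by exact: sqr_ge0.
(* Expand the form at u - t B(u,v) v; the factor B(u,v) makes the cross terms real. *)
have h (t : R) : 0 <= Re (B u u) - 2 * t * b + t ^+ 2 * b * Re (B v v).
  have := Re_ge0 (form_ge0 B (u - (t%:C%C * B u v) *: v)).
  rewrite formBl !formBr !formZl !formZr (form_conj B u v) conjCM conjC_real.
  rewrite [X in 0 <= Re X -> _](_ : _ = B u u
     - (2 * t)%:C%C * (B u v * Num.conj (B u v))
     + (t ^+ 2)%:C%C * (B u v * Num.conj (B u v)) * B v v); last first.
    by rewrite rmorphXn rmorphM/= rmorph_nat; ring.
  rewrite mul_conj_normc -!rmorphM/= ReD ReD raddfN/= Re_realM.
  by congr (_ <= _ + _ + _).
have := Re_ge0 (form_ge0 B v); rewrite le0r => /predU1P[v0|v0].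
  (* If B(v,v) = 0 the bound is affine in t, and this t makes it equal to -1 unless [b] is 0. *)
  rewrite v0 mulr0; have := h ((Re (B u u) + 1) / (2 * b)); rewrite v0 mulr0 addr0.
  have [->//|bn0 h'] := eqVneq b 0; suff : (0 : R) <= -1 by lra.
  apply: le_trans h' _; rewrite [X in X <= _](_ : _ = -1)//.
  by field; rewrite bn0.
(* The minimiser of the quadratic in t. *)
have := h (Re (B v v))^-1.
rewrite [X in 0 <= X](_ : _ = Re (B u u) - b / Re (B v v)).
  by rewrite subr_ge0 ler_pdivrMr.
by field; rewrite gt_eqF.
Qed.

Lemma normc_form_le u v : normc (B u v) <= seminorm u * seminorm v.
Proof.
rewrite -(@ler_pXn2r _ 2)// ?nnegrE ?normc_ge0 ?mulr_ge0 ?seminorm_ge0//.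
by rewrite exprMn !sqr_seminorm sqr_normc_form_le.
Qed.

Lemma seminormZ c u : seminorm (c *: u) = normc c * seminorm u.
Proof.
apply/eqP; rewrite -(@eqrXn2 _ 2)// ?mulr_ge0 ?normc_ge0 ?seminorm_ge0//.
rewrite exprMn !sqr_seminorm formZl formZr mulrA mul_conj_normc.
by rewrite Re_realM.
Qed.

Lemma seminormD u v : seminorm (u + v) <= seminorm u + seminorm v.
Proof.
rewrite -(@ler_pXn2r _ 2)// ?nnegrE ?addr_ge0 ?seminorm_ge0//.
rewrite sqrrD !sqr_seminorm formDl !formDr !ReD (form_conj B u v) complexRe_conj.
have := ler_norm (Re (B u v)); have := ler_Re_normc (B u v).
have := normc_form_le u v; lra.
Qed.

End PsdForm.

(** * Completion of a semi-inner product space as a space of functionals *)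

Section Completion.
Variables (R : realType) (V : lmodType R[i]) (B : psd_form V).
Local Notation C := R[i].
Local Notation p := (seminorm B).
Implicit Types (f g : V -> C) (u v b : V) (e M : R).

(** [M] bounds the dual norm of [f]; for f = <x, .> this means that x has norm at most [M]. *)
Definition form_bounded f M := forall b, normc (f b) <= M * p b.

Definition form_approx f v e := form_bounded (f - B v) e.

(* A vector [x] of the Hilbert space completing [(V, B)] is encoded by the    *)
(* conjugate-linear functional [fun b => <x, b>] on [V].                      *)
Definition in_completion : {pred (V -> C)} :=
  mem [set f | forall e, 0 < e -> exists v, form_approx f v e].

Lemma form_bounded_linear c f g M N : form_bounded f M -> form_bounded g N ->
  form_bounded (c *: f + g) (normc c * M + N).
Proof.
move=> hf hg b; rewrite fctE/= (le_trans (ler_normcD _ _))//.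
rewrite normc_mul mulrDl -mulrA lerD//.
by rewrite ler_wpM2l ?normc_ge0.
Qed.

Lemma form_bounded_form v : form_bounded (B v) (p v).
Proof. by move=> b; exact: normc_form_le. Qed.

Lemma form_boundedW f M N : M <= N -> form_bounded f M -> form_bounded f N.
Proof.
by move=> MN hf b; rewrite (le_trans (hf b))// ler_wpM2r ?seminorm_ge0.
Qed.

(** Test the functional at [v] itself: p(v)^2 <= M p(v). *)
Lemma seminorm_le v M : 0 <= M -> form_bounded (B v) M -> p v <= M.
Proof.
move=> M0 /(_ v); rewrite form_seminorm normc_real ger0_norm ?sqr_ge0//.
by rewrite expr2; have := seminorm_ge0 B v; rewrite le0r => /predU1P[->//|v0];
  rewrite ler_pM2r.
Qed.

Lemma form_funB u v : B (u - v) = B u - B v.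
Proof. by apply/funext => b; rewrite formBl. Qed.

Lemma form_fun_linear c u v : B (c *: u + v) = c *: (B u : V -> C) + B v.
Proof. by apply/funext => b; rewrite form_linear. Qed.

Lemma form_boundedD f g M N : form_bounded f M -> form_bounded g N ->
  form_bounded (f + g) (M + N).
Proof.
move=> /(@form_bounded_linear 1 f g M N) h /h.
by rewrite scale1r ComplexField.Normc.normc1 mul1r.
Qed.

Lemma form_boundedN f M : form_bounded f M -> form_bounded (- f) M.
Proof. by move=> h b; rewrite fctE normc_opp. Qed.

Lemma form_approx_form v e : 0 <= e -> form_approx (B v) v e.
Proof.
move=> e0 b; have -> : ((B v : V -> C) - B v) b = 0 by exact: subrr.
by rewrite ComplexField.Normc.normc0 mulr_ge0 ?seminorm_ge0.
Qed.

Lemma form_approx_seminormB f u v d e : 0 <= d -> 0 <= e ->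
  form_approx f u d -> form_approx f v e -> p (u - v) <= d + e.
Proof.
move=> d0 e0 hu hv; apply: seminorm_le; first exact: addr_ge0.
rewrite form_funB.
have -> : (B u - B v : V -> C) = (f - B v) - (f - B u).
  by apply/funext => b; rewrite !fctE/=; ring.
by rewrite addrC; apply: form_boundedD => //; exact: form_boundedN.
Qed.

Lemma form_approx_bounded f v e : form_approx f v e -> form_bounded f (e + p v).
Proof.
move=> h; rewrite -(subrK (B v : V -> C) f).
by apply: form_boundedD => //; exact: form_bounded_form.
Qed.

Lemma form_approx_seminorm f v e M : 0 <= e -> 0 <= M ->
  form_approx f v e -> form_bounded f M -> p v <= M + e.
Proof.
move=> e0 M0 h hf; apply: seminorm_le; first exact: addr_ge0.
rewrite -[form_fun B v](subKr f).
by apply: form_boundedD => //; exact: form_boundedN.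
Qed.

Lemma in_completion_form v : (B v : V -> C) \in in_completion.
Proof. by apply/mem_set => e /ltW e0; exists v; exact: form_approx_form. Qed.

Lemma in_completionP f :
  reflect (forall e, 0 < e -> exists v, form_approx f v e) (f \in in_completion).
Proof. by apply: (iffP idP) => [/set_mem//|h]; apply/mem_set. Qed.

Lemma in_completion_submod : submod_closed in_completion.
Proof.
split.
  have -> : (0 : V -> C) = B 0 by apply/funext => b; rewrite form0l.
  exact: in_completion_form.
move=> c f g /in_completionP hf /in_completionP hg; apply/in_completionP => e e0.
have c0 := normc_ge0 c.
(* The [+ 1] keeps the denominator positive when c = 0. *)
have [u hu] := hf (e / 2 / (normc c + 1)) ltac:(by rewrite !divr_gt0//; lra).
have [v hv] := hg (e / 2) ltac:(lra).
exists (c *: u + v); rewrite /form_approx form_fun_linear.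
have -> : c *: f + g - (c *: (B u : V -> C) + B v) = c *: (f - B u) + (g - B v).
  by rewrite scalerBr opprD addrACA.
apply: form_boundedW (form_bounded_linear c hu hv).
have : normc c * (e / 2 / (normc c + 1)) <= e / 2.
  by rewrite mulrCA ler_piMr//; [lra | rewrite ler_pdivrMr; lra].
lra.
Qed.

HB.instance Definition _ :=
  GRing.isSubmodClosed.Build R[i] (V -> C) in_completion in_completion_submod.

Record completion := Completion {
  completion_fun :> V -> C;
  completion_subproof : completion_fun \in in_completion
}.

HB.instance Definition _ := [isSub for completion_fun].
HB.instance Definition _ := [Choice of completion by <:].
HB.instance Definition _ := [SubChoice_isSubLmodule of completion by <:].

End Completion.

(** * Inner product and norm of the completion *)

Section CompletionInner.
Variables (R : realType) (V : lmodType R[i]) (B : psd_form V).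
Local Notation C := R[i].
Local Notation H := (completion B).
Local Notation p := (seminorm B).
Implicit Types (f g h : H) (u v b : V) (e M : R).

Definition completion_of v : H := Completion (in_completion_form B v).

Lemma completionE f g : (forall b, f b = g b) -> f = g.
Proof. by move=> fg; apply/val_inj/funext. Qed.

Lemma completion_funD f g b : (f + g) b = f b + g b.
Proof. by []. Qed.

Lemma completion_funB f g b : (f - g) b = f b - g b.
Proof. by []. Qed.

Lemma completion_funZ c f b : (c *: f) b = c * f b.
Proof. by []. Qed.

Lemma completion_approx f e : 0 < e -> exists v, form_approx B f v e.
Proof. by move: e; apply/in_completionP; exact: completion_subproof. Qed.

Lemma completion_bounded f : exists2 M, 0 <= M & form_bounded B f M.
Proof.
have [v hv] := completion_approx f ltr01.
by exists (1 + p v); [rewrite addr_ge0 ?seminorm_ge0 | exact: form_approx_bounded].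
Qed.

Lemma invS_gt0 n : 0 < n.+1%:R^-1 :> R.
Proof. by rewrite invr_gt0. Qed.

Lemma invS_small e : 0 < e -> exists N : nat, forall n, (N <= n)%N ->
  n.+1%:R^-1 <= e.
Proof.
move=> e0; exists (Num.bound e^-1) => n Nn.
rewrite -[e]invrK lef_pV2 ?posrE ?invr_gt0//.
have /archi_boundP/ltW/le_trans : 0 <= e^-1 by rewrite invr_ge0 ltW.
by apply; rewrite ler_nat (leq_trans Nn).
Qed.

Definition approx_seq f n : V := sval (cid (completion_approx f (invS_gt0 n))).

Lemma approx_seqP f n : form_approx B f (approx_seq f n) n.+1%:R^-1.
Proof. by rewrite /approx_seq; case: cid. Qed.

(** Additivity is inherited from the functionals [B w] approximating [f]; [K] collects the seminorms
    that multiply the error. *)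
Lemma completion_funDr f u v : f (u + v) = f u + f v.
Proof.
have [M M0 hM] := completion_bounded f.
apply/eqP; rewrite -subr_eq0; apply/eqP/normc_small_eq0 => e e0.
pose K := p (u + v) + p u + p v + 1.
have [[pu pv] puv] := (seminorm_ge0 B u, seminorm_ge0 B v, seminorm_ge0 B (u + v)).
have K0 : 0 < K by rewrite /K; lra.
have [w hw] := completion_approx f (divr_gt0 e0 K0).
have -> : f (u + v) - (f u + f v) =
    (f (u + v) - B w (u + v)) - (f u - B w u) - (f v - B w v).
  by rewrite formDr; ring.
have := hw (u + v); have := hw u; have := hw v; rewrite !fctE => h1 h2 h3.
rewrite (le_trans (ler_normcD _ _))// normc_opp.
rewrite (le_trans (lerD (ler_normcD _ _) (lexx _)))// normc_opp.
rewrite (le_trans (lerD (lerD h3 h2) h1))// -!mulrDr -mulrA ler_piMr ?(ltW e0)//.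
by rewrite mulrC ler_pdivrMr// mul1r /K; lra.
Qed.

Lemma completion_funZr c f u : f (c *: u) = Num.conj c * f u.
Proof.
apply/eqP; rewrite -subr_eq0; apply/eqP/normc_small_eq0 => e e0.
pose K := p (c *: u) + normc c * p u + 1.
have [[pu pcu] c0] := (seminorm_ge0 B u, seminorm_ge0 B (c *: u), normc_ge0 c).
have cu0 : 0 <= normc c * p u by exact: mulr_ge0.
have K0 : 0 < K by rewrite /K; lra.
have [w hw] := completion_approx f (divr_gt0 e0 K0).
have -> : f (c *: u) - Num.conj c * f u =
    (f (c *: u) - B w (c *: u)) - Num.conj c * (f u - B w u).
  by rewrite formZr; ring.
have := hw (c *: u); have := hw u; rewrite !fctE => h1 h2.
rewrite (le_trans (ler_normcD _ _))// normc_opp normc_mul normc_conj.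
rewrite (le_trans (lerD h2 (ler_wpM2l c0 h1)))//.
rewrite mulrCA -!mulrDr -mulrA ler_piMr ?(ltW e0)//.
by rewrite mulrC ler_pdivrMr// mul1r /K; lra.
Qed.

Lemma completion_funBr f u v : f (u - v) = f u - f v.
Proof.
by rewrite completion_funDr -scaleN1r completion_funZr rmorphN1 mulN1r.
Qed.

Lemma approx_seq_cauchy f g :
  exists l, cconverges (fun n => f (approx_seq g n)) l.
Proof.
have [M M0 hM] := completion_bounded f.
apply: complex_cauchy_limit => e e0.
have [N hN] : exists N : nat, forall n, (N <= n)%N -> n.+1%:R^-1 <= e / 2 / (M + 1).
  by apply: invS_small; rewrite !divr_gt0//; lra.
exists N => m n Nm Nn; rewrite -completion_funBr.
rewrite (le_trans (hM _))//.
have hp : p (approx_seq g m - approx_seq g n) <= e / (M + 1).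
  have := form_approx_seminormB (ltW (invS_gt0 m)) (ltW (invS_gt0 n))
    (approx_seqP g m) (approx_seqP g n).
  move=> /le_trans; apply; rewrite (le_trans (lerD (hN _ Nm) (hN _ Nn)))//.
  by rewrite -mulrDl -splitr.
rewrite (le_trans (ler_wpM2l M0 hp))// mulrCA ler_piMr ?(ltW e0)//.
by rewrite ler_pdivrMr; lra.
Qed.

(** The limit of f(v_n) for vectors v_n approximating [g]. Linearity in [f] is then immediate; the
    other properties come from approximating [f] as well. *)
Definition completion_inner f g : C := sval (cid (approx_seq_cauchy f g)).
Local Notation "'<< f , g >>" := (completion_inner f g)
  (at level 0, format "''<<' f ,  g >>").

Lemma completion_innerP f g : cconverges (fun n => f (approx_seq g n)) '<<f, g>>.
Proof. by rewrite /completion_inner; case: cid. Qed.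

Lemma completion_inner_linear c f g h :
  '<<c *: f + g, h>> = c * '<<f, h>> + '<<g, h>>.
Proof.
apply: cconverges_unique (completion_innerP _ _) _.
exact: cconverges_linear (completion_innerP _ _) (completion_innerP _ _).
Qed.

Lemma completion_inner_bounded f g M N : 0 <= M -> 0 <= N ->
  form_bounded B f M -> form_bounded B g N -> normc '<<f, g>> <= M * N.
Proof.
move=> M0 N0 hM hN; apply/ler_addgt0Pr => e e0.
apply: cconverges_le (completion_innerP f g) _.
have [k hk] : exists N : nat, forall n, (N <= n)%N -> n.+1%:R^-1 <= e / (M + 1).
  by apply: invS_small; rewrite divr_gt0//; lra.
exists k => n kn; rewrite (le_trans (hM _))//.
have hp := form_approx_seminorm (ltW (invS_gt0 n)) N0 (approx_seqP g n) hN.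
rewrite (le_trans (ler_wpM2l M0 hp))// mulrDr lerD2l.
rewrite (le_trans (ler_wpM2l M0 (hk _ kn)))// mulrCA ler_piMr ?(ltW e0)//.
by rewrite ler_pdivrMr; lra.
Qed.

Lemma completion_inner_of f u : '<<f, completion_of u>> = f u.
Proof.
apply: cconverges_unique (completion_innerP _ _) _ => e e0.
have [M M0 hM] := completion_bounded f.
have [k hk] : exists N : nat, forall n, (N <= n)%N -> n.+1%:R^-1 <= e / (M + 1).
  by apply: invS_small; rewrite divr_gt0//; lra.
exists k => n kn; rewrite -completion_funBr (le_trans (hM _))//.
have := form_approx_seminormB (ltW (invS_gt0 n)) (lexx 0)
  (approx_seqP (completion_of u) n) (form_approx_form B u (lexx 0)).
rewrite addr0 => hp; rewrite (le_trans (ler_wpM2l M0 (le_trans hp (hk _ kn))))//.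
by rewrite mulrCA ler_piMr ?(ltW e0)// ler_pdivrMr; lra.
Qed.

Lemma completion_of_inner u g : '<<completion_of u, g>> = Num.conj (g u).
Proof.
apply: cconverges_unique (completion_innerP _ _) _ => e e0 /=.
have [k hk] : exists N : nat, forall n, (N <= n)%N -> n.+1%:R^-1 <= e / (p u + 1).
  by apply: invS_small; rewrite divr_gt0//; have := seminorm_ge0 B u; lra.
exists k => n kn; rewrite form_conj -conjCB normc_conj normcB.
have := approx_seqP g n u; rewrite fctE => /le_trans; apply.
rewrite (le_trans (ler_wpM2r (seminorm_ge0 _ _) (hk _ kn)))//.
rewrite mulrAC -mulrA ler_piMr ?(ltW e0)//.
by rewrite ler_pdivrMr; have := seminorm_ge0 B u; lra.
Qed.

Lemma completion_innerBl f g h : '<<f - g, h>> = '<<f, h>> - '<<g, h>>.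
Proof.
by rewrite addrC -scaleN1r completion_inner_linear mulN1r addrC.
Qed.

(** For u_n approximating [f], g(u_n) is the conjugate of <u_n, g>, which converges to <f, g>. *)
Lemma completion_inner_conj f g : '<<g, f>> = Num.conj '<<f, g>>.
Proof.
suff : cconverges (fun n => g (approx_seq f n)) (Num.conj '<<f, g>>).
  exact: cconverges_unique (completion_innerP _ _).
move=> e e0; have [M M0 hM] := completion_bounded g.
have [k hk] : exists N : nat, forall n, (N <= n)%N -> n.+1%:R^-1 <= e / (M + 1).
  by apply: invS_small; rewrite divr_gt0//; lra.
exists k => n kn.
rewrite -[g _]conjCK -completion_of_inner -conjCB normc_conj -completion_innerBl.
have hb : form_bounded B (completion_of (approx_seq f n) - f) n.+1%:R^-1.
  by move=> b; rewrite completion_funB normcB; exact: approx_seqP.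
rewrite (le_trans (completion_inner_bounded (ltW (invS_gt0 n)) M0 hb hM))//.
rewrite (le_trans (ler_wpM2r M0 (hk _ kn)))// mulrAC -mulrA ler_piMr ?(ltW e0)//.
by rewrite ler_pdivrMr; lra.
Qed.

Lemma completion_inner_ge0 f : 0 <= '<<f, f>>.
Proof.
have := completion_inner_conj f f.
rewrite lecE /=; case E : '<<f, f>> => [a b] [hb] /=.
apply/andP; split; first by apply/eqP; lra.
have [M M0 hM] := completion_bounded f.
suff : - a <= 0 by rewrite oppr_le0.
apply/ler_addgt0Pr => e e0; rewrite add0r.
have [k hk] : exists N : nat, forall n, (N <= n)%N -> n.+1%:R^-1 <= e / 2 / (M + 1).
  by apply: invS_small; rewrite !divr_gt0//; lra.
have [k' hk'] := completion_innerP f f (divr_gt0 e0 (ltr0Sn _ 1)).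
have := hk _ (leq_maxl k k'); have := hk' _ (leq_maxr k k').
set n := maxn k k'; set v := approx_seq f n; rewrite E => h1 h2.
have h3 : normc (f v - B v v) <= n.+1%:R^-1 * p v by exact: approx_seqP.
have hp := form_approx_seminorm (ltW (invS_gt0 n)) M0 (approx_seqP f n) hM.
have n1 : n.+1%:R^-1 <= 1 :> R by rewrite invf_le1 ?ler1n.
have h4 : normc (f v - B v v) <= e / 2.
  apply: le_trans h3 _; have p0 := seminorm_ge0 B v.
  rewrite (le_trans (ler_wpM2r p0 h2))// mulrAC ler_pdivrMr; last by lra.
  by apply: ler_wpM2l; [lra | apply: le_trans hp _; rewrite lerD2l].
have v0 := Re_ge0 (form_ge0 B v).
(* <f, f> is within e/2 of f(v), which is within e/2 of B(v,v) >= 0; so its real part is at least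
   -e. *)
have := le_trans (ler_Re_normc _) h4; have := le_trans (ler_Re_normc _) h1.
rewrite !raddfB/= !ler_norml; lra.
Qed.

Definition completion_form : psd_form H :=
  PsdForm completion_inner_linear completion_inner_conj completion_inner_ge0.

Lemma seminorm_completion_of v : seminorm completion_form (completion_of v) = p v.
Proof. by rewrite /seminorm /= completion_inner_of. Qed.

Lemma form_bounded_seminorm f : form_bounded B f (seminorm completion_form f).
Proof.
move=> b; have := normc_form_le completion_form f (completion_of b).
rewrite seminorm_completion_of.
by have -> : completion_form f (completion_of b) = f b by exact: completion_inner_of.
Qed.

(** With [form_bounded_seminorm], this identifies the norm with the least bound of the
    functional. *)
Lemma completion_seminorm_le f M : 0 <= M -> form_bounded B f M ->
  seminorm completion_form f <= M.
Proof.
move=> M0 hM; rewrite -(@ler_pXn2r _ 2)// ?nnegrE ?seminorm_ge0//.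
rewrite sqr_seminorm (le_trans (ler_norm _))// (le_trans (ler_Re_normc _))//.
exact: completion_inner_bounded.
Qed.

Lemma completion_seminorm_eq0 f : seminorm completion_form f = 0 -> f = 0.
Proof.
move=> f0; apply: completionE => b; apply: normc_le0_eq0.
by have := form_bounded_seminorm f b; rewrite f0 mul0r.
Qed.

Definition completion_norm f : C := (seminorm completion_form f)%:C%C.

Lemma completion_norm_triangle f g :
  completion_norm (f + g) <= completion_norm f + completion_norm g.
Proof. by rewrite -rmorphD lecR seminormD. Qed.

Lemma completion_normZ c f : completion_norm (c *: f) = `|c| * completion_norm f.
Proof. by rewrite normr_normc -rmorphM /completion_norm seminormZ. Qed.

Lemma completion_norm_eq0 f : completion_norm f = 0 -> f = 0.
Proof. by move=> /complexI /completion_seminorm_eq0. Qed.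

HB.instance Definition _ := Lmodule_isNormed.Build C H
  completion_norm_triangle completion_normZ completion_norm_eq0.

Lemma completion_normE f : `|f| = (seminorm completion_form f)%:C%C.
Proof. by []. Qed.

Lemma form_bounded_lt_norm f M : `|f| < M%:C%C -> form_bounded B f M.
Proof.
rewrite completion_normE ltcR => /ltW h.
exact: form_boundedW h (form_bounded_seminorm f).
Qed.

End CompletionInner.

(** * Completeness of the completion *)

Section CompletionHilbert.
Variables (R : realType) (V : lmodType R[i]) (B : psd_form V).
Local Notation C := R[i].
Local Notation H := (completion B).

Lemma completion_norm_le (f : H) (M : R) : 0 <= M -> form_bounded B f M ->
  `|f| <= M%:C%C.
Proof. by move=> M0 hM; rewrite completion_normE lecR completion_seminorm_le. Qed.

Lemma completion_dense_of (f : H) (e : R) : 0 < e ->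
  exists v, `|f - completion_of B v| <= e%:C%C.
Proof.
move=> e0; have [v hv] := completion_approx f e0.
by exists v; apply: completion_norm_le => //; exact: ltW.
Qed.

(** The centres x_n of balls of radius 1/(n+1) belonging to the filter converge pointwise as
    functionals, and the uniform estimates survive in the limit. *)
Lemma completion_complete (F : set_system H) :
  ProperFilter F -> cauchy F -> cvg F.
Proof.
move=> FF /cauchyP hF.
have h (n : nat) : {x : H | F (ball x (n.+1%:R^-1)%:C%C)}.
  by apply/cid/hF; rewrite -(rmorph0 (real_complex R)) ltcR invS_gt0.
pose x n : H := sval (h n).
have xP n : F (ball (x n) (n.+1%:R^-1)%:C%C) by exact: svalP (h n).
have x_close n m : form_bounded B (x n - x m) (n.+1%:R^-1 + m.+1%:R^-1).
  apply: form_bounded_lt_norm.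
  have [y [yn ym]] := filter_ex (filterI (xP n) (xP m)).
  have := yn; have := ym; rewrite -!ball_normE /= => ym' yn'.
  have -> : x n - x m = (x n - y) + (y - x m) by rewrite addrA subrK.
  rewrite (le_lt_trans (ler_normD _ _))// rmorphD/= ltrD// distrC//.
have [l hl] : exists l : V -> C, forall b, cconverges (fun n => x n b) (l b).
  suff : forall b, exists z, cconverges (fun n => x n b) z.
    by move=> /choice[l hl]; exists l.
  move=> b; apply: complex_cauchy_limit => e e0.
  have b0 := seminorm_ge0 B b.
  have [N hN] : exists N : nat, forall n, (N <= n)%N ->
      n.+1%:R^-1 <= e / 2 / (seminorm B b + 1).
    by apply: invS_small; rewrite !divr_gt0//; lra.
  exists N => m n Nm Nn; rewrite -completion_funB.
  rewrite (le_trans (x_close _ _ _))//.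
  rewrite (le_trans (ler_wpM2r b0 (lerD (hN _ Nm) (hN _ Nn))))//.
  rewrite -mulrDl -splitr mulrAC ler_pdivrMr; last by lra.
  by apply: ler_wpM2l; [exact: ltW | lra].
(* Let m tend to infinity in [x_close m n]. *)
have lx n : form_bounded B (l - x n) n.+1%:R^-1.
  move=> b; have b0 := seminorm_ge0 B b; apply/ler_addgt0Pr => e e0.
  have [N hN] := hl b _ (divr_gt0 e0 (ltr0Sn _ 1)).
  have [k hk] : exists N : nat, forall n, (N <= n)%N ->
      n.+1%:R^-1 <= e / 2 / (seminorm B b + 1).
    by apply: invS_small; rewrite !divr_gt0//; lra.
  have := hN _ (leq_maxl N k); have := hk _ (leq_maxr N k).
  set m := maxn N k => h1 h2; have h3 := x_close m n b.
  have -> : (l - x n : V -> C) b = (x m - x n : H) b - (x m b - l b).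
    by rewrite completion_funB -[LHS]/(l b - x n b); ring.
  rewrite (le_trans (ler_normcD _ _))// normc_opp (le_trans (lerD h3 h2))//.
  rewrite mulrDl; suff : m.+1%:R^-1 * seminorm B b <= e / 2.
    by move: (m.+1%:R^-1 * _) (n.+1%:R^-1 * _) => a c; lra.
  rewrite (le_trans (ler_wpM2r b0 h1))// mulrAC ler_pdivrMr; last by lra.
  by apply: ler_wpM2l; lra.
have lH : l \in in_completion B.
  apply/in_completionP => e e0.
  have [k hk] := invS_small (divr_gt0 e0 (ltr0Sn _ 1)).
  have [v hv] := completion_approx (x k) (divr_gt0 e0 (ltr0Sn _ 1)).
  exists v; rewrite /form_approx.
  have -> : l - B v = (l - (x k : V -> C)) + ((x k : V -> C) - B v).
    by rewrite addrA subrK.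
  rewrite [e]splitr; apply: form_boundedD hv.
  by apply: form_boundedW (lx k); exact: hk.
pose y := Completion lH.
have xy n : `|y - x n| <= (n.+1%:R^-1)%:C%C.
  by apply: completion_norm_le; [exact/ltW/invS_gt0 | exact: lx].
apply/cvg_ex; exists y; apply/cvg_ballP => e e0.
have -> : e = (Re e)%:C%C by apply: complex_ge0; exact: ltW.
have e0' : 0 < Re e by move: e0; rewrite ltcE /= => /andP[].
have [k hk] := invS_small (divr_gt0 e0' (ltr0Sn _ 2)).
apply: filterS (xP k) => z; rewrite -!ball_normE /= => hz.
have -> : y - z = (y - x k) + (x k - z) by rewrite addrA subrK.
rewrite (le_lt_trans (ler_normD _ _))//.
have := ler_ltD (xy k) hz; move/lt_le_trans; apply.
rewrite -rmorphD lecR; have := hk k (leqnn k); move: k.+1%:R^-1 => a; lra.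
Qed.

HB.instance Definition _ := Uniform_isComplete.Build H completion_complete.

End CompletionHilbert.

(** * The completion as a Hilbert space *)

Section CompletionInnerProduct.
Variables (R : realType) (V : lmodType R[i]) (B : psd_form V).
Local Notation C := R[i].
Local Notation H := (completion B).
Local Notation inner0 := (@completion_inner R V B).

Lemma completion_inner_bilinear :
  bilinear_for (GRing.Scale.Law.clone _ _ *%R _)
    (GRing.Scale.Law.clone _ _ (Num.conj \; *%R) _) inner0.
Proof.
split=> [g c f h|f c g h].
  exact: completion_inner_linear.
have D := formDr (completion_form B) (c *: g) h f.
have Z := formZr (completion_form B) c g f.
by rewrite /= in D Z *; rewrite D Z.
Qed.

HB.instance Definition _ := bilinear_isBilinear.Build C H H C
  (GRing.Scale.Law.clone _ _ *%R _)
  (GRing.Scale.Law.clone _ _ (Num.conj \; *%R) _) inner0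
  completion_inner_bilinear.

Lemma completion_inner_hermitian (f g : H) :
  inner0 f g = (-1) ^+ false * Num.conj (inner0 g f).
Proof. by rewrite mul1r; exact: completion_inner_conj. Qed.

HB.instance Definition _ := isHermitianSesquilinear.Build C H false Num.conj
  inner0 completion_inner_hermitian.

Lemma completion_inner_gt0 (f : H) : f != 0 -> 0 < inner0 f f.
Proof.
move=> f0; rewrite lt0r completion_inner_ge0 andbT.
apply: contra f0 => /eqP h; apply/eqP/completion_seminorm_eq0.
by rewrite /seminorm /= h sqrtr0.
Qed.

HB.instance Definition _ := isDotProduct.Build C H inner0 completion_inner_gt0.

Lemma completion_inner_norm (f : H) : inner0 f f = `|f| ^+ 2.
Proof.
by rewrite completion_normE -rmorphXn; exact: form_seminorm (completion_form B) f.
Qed.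

HB.instance Definition _ := isHilbertSpace.Build R H completion_inner_norm.

End CompletionInnerProduct.

(** * C*-algebras: the norm and square roots of 1 - h *)

Section CStar.
Variables (R : realType) (A : cstarAlgType R).
Implicit Types (a b h x y : A).

Lemma starB a b : star (a - b) = star a - star b.
Proof. by rewrite starD -scaleN1r starZ rmorphN1 scaleN1r. Qed.

Lemma star0 : star (0 : A) = 0.
Proof. by rewrite -{1}(subrr (0 : A)) starB subrr. Qed.

Lemma star1 : star (1 : A) = 1.
Proof. by have := starM (star 1 : A) 1; rewrite mulr1 starK mulr1. Qed.

Lemma cnorm0 : cnorm (0 : A) = 0.
Proof. by rewrite -(scale0r (0 : A)) cnormZ ComplexField.Normc.normc0 mul0r. Qed.

Lemma cnormN a : cnorm (- a) = cnorm a.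
Proof.
by rewrite -scaleN1r cnormZ normc_opp ComplexField.Normc.normc1 mul1r.
Qed.

Lemma cnorm_ge0 a : 0 <= cnorm a.
Proof. by have := ler_cnormD a (- a); rewrite subrr cnorm0 cnormN; lra. Qed.

(** From the C*-identity: |a|^2 = |star(a) a| <= |star(a)| |a|. *)
Lemma cnorm_star_le a : cnorm a <= cnorm (star a).
Proof.
have := ler_cnormM (star a) a; rewrite cnorm_starM expr2.
have := cnorm_ge0 a; rewrite le0r => /predU1P[->|a0]; first by rewrite cnorm_ge0.
by rewrite ler_pM2r.
Qed.

Lemma cnorm_star a : cnorm (star a) = cnorm a.
Proof. by apply: le_anti; rewrite cnorm_star_le -{2}(starK a) cnorm_star_le. Qed.

Lemma cnorm_le0 a : (forall e : R, 0 < e -> cnorm a <= e) -> a = 0.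
Proof.
move=> h; apply: cnorm0_eq0; apply: le_anti; rewrite cnorm_ge0 andbT.
by apply/ler_addgt0Pr => e e0; rewrite add0r h.
Qed.

Lemma cnorm_cvgP (u : nat -> A) (l : A) :
  cnorm (u m - l) @[m --> \oo] --> (0 : R) <->
  forall e : R, 0 < e -> exists N : nat, forall n, (N <= n)%N ->
    cnorm (u n - l) <= e.
Proof.
split=> [/cvgrPdist_le h e /h [N _ hN]|h].
  exists N => n /hN /=.
  by rewrite add0r normrN ger0_norm// cnorm_ge0.
apply/cvgrPdist_le => e /h [N hN]; exists N => // n /hN /=.
by rewrite add0r normrN ger0_norm// cnorm_ge0.
Qed.

Lemma exists_expr_le (r e : R) : 0 <= r < 1 -> 0 < e ->
  exists N : nat, r ^+ N <= e.
Proof.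
move=> /andP[r0 r1] e0.
have : (fun n => r ^+ n) @ \oo --> 0 by apply: cvg_expr; rewrite ger0_norm.
move=> /cvgrPdist_le /(_ _ e0) [N _ hN]; exists N.
have := hN N (leqnn N); rewrite /= add0r normrN ger0_norm//.
exact: exprn_ge0.
Qed.

(* [1 - y] is the square root of [1 - h] as soon as [y] is a fixed point of   *)
(* this map, which is a contraction of the ball of radius [cnorm h < 1].      *)
Definition sqrt_step h y : A := 2^-1 *: (h + y * y).

Lemma normc_half : normc (2^-1 : R[i]) = 2^-1.
Proof.
have -> : (2^-1 : R[i]) = (2^-1)%:C%C by rewrite fmorphV rmorph_nat.
by rewrite normc_real ger0_norm// invr_ge0.
Qed.

Section SquareRoot.
Variables (h : A) (h_lt1 : cnorm h < 1).
Let rho := cnorm h.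
Let y n := iter n (sqrt_step h) 0.

Let y_le n : cnorm (y n) <= rho.
Proof.
elim: n => [|n IH]; first by rewrite cnorm0 cnorm_ge0.
rewrite /= cnormZ normc_half (le_trans (ler_wpM2l _ (ler_cnormD _ _)))//.
have yy : cnorm (y n * y n) <= rho * rho.
  by rewrite (le_trans (ler_cnormM _ _))// ler_pM ?cnorm_ge0.
have : rho * rho <= rho by rewrite ler_piMr ?cnorm_ge0// ltW.
by rewrite -/(y n) -/rho; lra.
Qed.

Lemma sqrt_step_contraction x x' : cnorm x <= rho -> cnorm x' <= rho ->
  cnorm (sqrt_step h x - sqrt_step h x') <= rho * cnorm (x - x').
Proof.
move=> xr xr'; rewrite -scalerBr cnormZ normc_half.
have -> : h + x * x - (h + x' * x') = x * (x - x') + (x - x') * x'.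
  by rewrite mulrBr mulrBl addrA subrK opprD addrACA subrr add0r.
rewrite (le_trans (ler_wpM2l _ (ler_cnormD _ _)))//.
have h1 : cnorm (x * (x - x')) <= rho * cnorm (x - x').
  by rewrite (le_trans (ler_cnormM _ _))// ler_wpM2r ?cnorm_ge0.
have h2 : cnorm ((x - x') * x') <= rho * cnorm (x - x').
  by rewrite (le_trans (ler_cnormM _ _))// mulrC ler_wpM2r ?cnorm_ge0.
by lra.
Qed.

(** Each of [N] common steps contracts by [rho], and two points of the ball of radius [rho] < 1 are
    at distance at most 2. *)
Let y_close N m n : (N <= m)%N -> (N <= n)%N ->
  cnorm (y m - y n) <= rho ^+ N * 2.
Proof.
elim: N m n => [m n _ _|N IH [//|m] [//|n]].
  rewrite expr0 mul1r (le_trans (ler_cnormD _ _))// cnormN.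
  by have := h_lt1; have := y_le m; have := y_le n; rewrite -/rho; lra.
rewrite !ltnS => Nm Nn.
rewrite (le_trans (sqrt_step_contraction (y_le m) (y_le n)))//.
by rewrite exprS -mulrA ler_wpM2l ?cnorm_ge0// IH.
Qed.

Lemma sqrt_step_fixpoint : star h = h ->
  exists2 l, star l = l & sqrt_step h l = l.
Proof.
move=> hh; have r0 : 0 <= rho by exact: cnorm_ge0.
have [|l hl] := cnorm_complete y.
  move=> e e0; have [N hN] := @exists_expr_le rho (e / 4) ltac:(by rewrite r0) ltac:(lra).
  by exists N => m n Nm Nn; apply: le_lt_trans (y_close Nm Nn) _; lra.
move/cnorm_cvgP in hl.
have y_star n : star (y n) = y n.
  elim: n => [|n IH]; first exact: star0.
  by rewrite /= starZ starD starM -/(y n) IH hh rmorphV ?unitfE// rmorph_nat.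
exists l.
  apply/eqP; rewrite -subr_eq0; apply/eqP/cnorm_le0 => e e0.
  have [N hN] := hl (e / 2) ltac:(lra); have hN' := hN N (leqnn N).
  have -> : star l - l = (y N - l) - star (y N - l).
    by rewrite starB y_star opprB [RHS]addrC addrA subrK.
  by rewrite (le_trans (ler_cnormD _ _))// cnormN cnorm_star; lra.
have l_le : cnorm l <= rho.
  apply/ler_addgt0Pr => e e0; have [N hN] := hl e e0.
  have -> : l = y N - (y N - l) by rewrite opprB addrC subrK.
  rewrite (le_trans (ler_cnormD _ _))// cnormN lerD//.
  exact: hN.
apply/eqP; rewrite -subr_eq0; apply/eqP/cnorm_le0 => e e0.
have [N hN] := hl (e / 2) ltac:(lra).
have h1 := hN N (leqnn N); have h2 := hN N.+1 (leqnSn N).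
(* Compare with the iterate [N.+1], which is both close to [l] and one step from the iterate [N]. *)
have -> : sqrt_step h l - l = (y N.+1 - l) - (sqrt_step h (y N) - sqrt_step h l).
  by rewrite /= opprB [RHS]addrC addrA subrK.
rewrite (le_trans (ler_cnormD _ _))// cnormN.
have h3 := sqrt_step_contraction (y_le N) l_le.
have h4 : rho * cnorm (y N - l) <= cnorm (y N - l).
  by rewrite ler_piMl ?cnorm_ge0// ltW.
by lra.
Qed.

End SquareRoot.

(** A fixed point y satisfies h + y^2 = 2y, that is (1 - y)^2 = 1 - h. *)
Lemma exists_sqrt_1B h : star h = h -> cnorm h < 1 ->
  exists2 x, star x = x & x * x = 1 - h.
Proof.
move=> hh h1; have [y ys yh] := sqrt_step_fixpoint h1 hh.
exists (1 - y); first by rewrite starB star1 ys.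
have : h + y * y = 2 *: y by rewrite -[in RHS]yh scalerA divff// scale1r.
rewrite scaler_nat mulr2n => /(congr1 (fun z => z - y * y)).
rewrite addrK => ->.
by rewrite mulrBl mul1r mulrBr mulr1 !opprD !opprK !addrA.
Qed.

End CStar.

(** * States and the GNS construction *)

Section State.
Variables (R : realType) (A : cstarAlgType R) (w : {scalar A}).
Hypothesis hw : is_state w.
Local Notation C := R[i].
Implicit Types (a b x : A) (c : C).

Lemma state_star a : w (star a) = Num.conj (w a).
Proof.
have [w_ge0 w1] := hw.
(* The state is real at star(a + c)(a + c); c = 1 and c = i then compare imaginary and real
   parts. *)
have h c : Im (c * w (star a)) + Im (Num.conj c * w a) = 0.
  have := w_ge0 (a + c *: 1); rewrite starD starZ star1 mulrDl !mulrDr.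
  rewrite -!scalerAr -!scalerAl mulr1 !mul1r !linearD/= !linearZ/= w1 mulr1.
  have hc : Im (c * Num.conj c) = 0 by rewrite mul_conj_normc.
  have := w_ge0 a; rewrite !lecE => /andP[/eqP ha _] /andP[/eqP + _].
  by rewrite !ImD hc ha /=; lra.
have h1 := h 1; have hi := h 'i%C.
rewrite [X in Num.conj X]complexiE conjCi -complexiE in hi.
rewrite conjC1 !mul1r in h1.
case: (w a) (w (star a)) h1 hi => [u v] [p q] /= h1 hi.
by congr Complex; move: h1 hi; rewrite /= ; lra.
Qed.

Definition gns_form_fun a b : C := w (star b * a).

Lemma gns_form_linear c a b x :
  gns_form_fun (c *: a + b) x = c * gns_form_fun a x + gns_form_fun b x.
Proof. by rewrite /gns_form_fun mulrDr linearD/= -scalerAr linearZ. Qed.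

Lemma gns_form_conj a b : gns_form_fun b a = Num.conj (gns_form_fun a b).
Proof. by rewrite /gns_form_fun -state_star starM starK. Qed.

Lemma gns_form_ge0 a : 0 <= gns_form_fun a a.
Proof. by have [h _] := hw; exact: h. Qed.

Definition gns_form : psd_form A :=
  PsdForm gns_form_linear gns_form_conj gns_form_ge0.

Lemma gns_formE a b : gns_form a b = w (star b * a).
Proof. by []. Qed.

(** For t > |a|, the element 1 - star(a) a / t^2 is the square of a self-adjoint x, and positivity
    of the state at star(xb) xb is the inequality with t in place of |a|. Then t decreases to
    |a|. *)
Lemma state_mul_le a b :
  Re (w (star (a * b) * (a * b))) <= cnorm a ^+ 2 * Re (w (star b * b)).
Proof.
have b0 : 0 <= Re (w (star b * b)) by apply: Re_ge0; have [h _] := hw; exact: h.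
have a0 := cnorm_ge0 a.
suff h (t : R) : cnorm a < t ->
    Re (w (star (a * b) * (a * b))) <= t ^+ 2 * Re (w (star b * b)).
  set X := Re (w (star (a * b) * (a * b))) in h *.
  set Y := Re (w (star b * b)) in h b0 *.
  apply/ler_addgt0Pr => e e0.
  (* With d <= 1, (|a| + d)^2 exceeds |a|^2 by at most d (2|a| + 1), so this d costs at most [e]. *)
  pose d := Num.min 1 (e / ((2 * cnorm a + 1) * (Y + 1))).
  have d0 : 0 < d.
    by rewrite lt_min ltr01 divr_gt0// mulr_gt0//; lra.
  have d1 : d <= 1 by rewrite ge_min lexx.
  have de : d * ((2 * cnorm a + 1) * (Y + 1)) <= e.
    rewrite -ler_pdivlMr; first by rewrite ge_min lexx orbT.
    by rewrite mulr_gt0//; lra.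
  have := h (cnorm a + d) ltac:(lra) => /le_trans; apply.
  suff : d * ((2 * cnorm a + d) * Y) <= e by rewrite sqrrD; lra.
  apply: le_trans de; apply: ler_wpM2l; first exact: ltW.
  by apply: ler_pM; lra.
move=> at0; have t0 : 0 < t by lra.
pose h := ((t ^- 2)%:C%C) *: (star a * a).
have [||x xs xh] := @exists_sqrt_1B _ _ h.
- by rewrite /h starZ starM starK conjC_real.
- rewrite /h cnormZ cnorm_starM normc_real ger0_norm ?invr_ge0 ?sqr_ge0//.
  by rewrite mulrC ltr_pdivrMr ?exprn_gt0// mul1r ltrXn2r// ?nnegrE// ltW.
have [w_ge0 _] := hw; have := Re_ge0 (w_ge0 (x * b)).
have -> : star (x * b) * (x * b) =
    star b * b - ((t ^- 2)%:C%C) *: (star (a * b) * (a * b)).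
  rewrite !starM xs -mulrA [x * (x * b)]mulrA xh mulrBl mul1r mulrBr.
  by rewrite /h -!scalerAl -!scalerAr !mulrA.
rewrite linearB/= linearZ/= raddfB/= Re_realM subr_ge0 mulrC.
by rewrite ler_pdivrMr ?exprn_gt0// mulrC.
Qed.

Lemma state_sqr_le a : Re (w (star a * a)) <= cnorm a ^+ 2.
Proof.
have := state_mul_le a 1; rewrite !mulr1 star1.
by have [_ ->] := hw; rewrite /= mulr1.
Qed.

Lemma gns_seminorm_le a b :
  seminorm gns_form (a * b) <= cnorm a * seminorm gns_form b.
Proof.
rewrite -(@ler_pXn2r _ 2)// ?nnegrE ?mulr_ge0 ?seminorm_ge0 ?cnorm_ge0//.
by rewrite exprMn !sqr_seminorm state_mul_le.
Qed.

Local Notation H := (completion gns_form).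

Lemma gns_act_approx a (f : A -> C) v e : 0 <= e -> form_approx gns_form f v e ->
  form_approx gns_form (fun b => f (star a * b)) (a * v) (cnorm a * e).
Proof.
move=> e0 hv b; have := hv (star a * b).
rewrite -![(_ - _ : A -> C) _]/(_ - _) /= /gns_form_fun starM starK mulrA.
move=> /le_trans; apply; rewrite [cnorm a * e]mulrC -mulrA ler_wpM2l//.
by rewrite -(cnorm_star a) gns_seminorm_le.
Qed.

Lemma gns_act_in a (f : H) : (fun b => f (star a * b)) \in in_completion gns_form.
Proof.
apply/in_completionP => e e0; have a0 := cnorm_ge0 a.
have [v hv] := completion_approx f (divr_gt0 e0 (ltr_wpDl a0 ltr01)).
exists (a * v).
apply: form_boundedW (gns_act_approx a _ hv); last by rewrite divr_ge0//; lra.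
by rewrite mulrCA ler_piMr ?(ltW e0)// ler_pdivrMr; lra.
Qed.

(** In the encoding by functionals, <a x, b> = <x, star(a) b>, so [a] acts by precomposition. *)
Definition gns_act a (f : H) : H := Completion (gns_act_in a f).

Lemma gns_act_linear a : linear (gns_act a).
Proof. by move=> c f g; apply: completionE. Qed.

HB.instance Definition _ a :=
  GRing.isLinear.Build C H H *:%R (gns_act a) (gns_act_linear a).

Definition gns_rep a : {linear H -> H} := gns_act a.

Local Notation cp := (seminorm (completion_form gns_form)).

Lemma gns_act_seminorm a (f : H) : cp (gns_act a f) <= cnorm a * cp f.
Proof.
apply: completion_seminorm_le; first by rewrite mulr_ge0 ?cnorm_ge0 ?seminorm_ge0.
move=> b; rewrite (le_trans (form_bounded_seminorm f (star a * b)))//.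
rewrite [cnorm a * _]mulrC -mulrA ler_wpM2l ?seminorm_ge0//.
by rewrite -(cnorm_star a) gns_seminorm_le.
Qed.

Lemma gns_act_bounded a (f : H) : `|gns_act a f| <= (cnorm a)%:C%C * `|f|.
Proof. by rewrite !completion_normE -rmorphM lecR gns_act_seminorm. Qed.

Lemma gns_rep_continuous a : continuous (gns_rep a).
Proof.
apply: bounded_linear_continuous; apply/linear_boundedP; near=> M => f.
rewrite (le_trans (gns_act_bounded a f))// ler_wpM2r//.
by near: M; apply: nbhs_pinfty_ge; rewrite complex_real.
Unshelve. all: by end_near. Qed.

Lemma gns_act_of a v :
  gns_act a (completion_of gns_form v) = completion_of gns_form (a * v).
Proof.
apply: completionE => b.
by rewrite /= /gns_form_fun starM starK mulrA.
Qed.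

Lemma gns_act_adjoint a (f g : H) :
  inner (gns_act (star a) f) g = inner f (gns_act a g).
Proof.
pose CF := completion_form gns_form.
rewrite -[LHS]/(CF _ _) -[RHS]/(CF _ _).
set x := gns_act (star a) f.
have [[ca cx] cf] := (cnorm_ge0 a, seminorm_ge0 CF x, seminorm_ge0 CF f).
pose K := cp x + cp f * cnorm a + 1.
have ca0 : 0 <= cp f * cnorm a by exact: mulr_ge0.
have K0 : 0 < K by rewrite /K; lra.
apply/eqP; rewrite -subr_eq0; apply/eqP/normc_small_eq0 => e e0.
have [v hv] := completion_dense_of g (divr_gt0 e0 K0).
rewrite completion_normE lecR in hv.
set h := g - completion_of gns_form v in hv.
(* The identity is exact on vectors coming from [A], so [g] can be replaced by the small remainder
   [h]. *)
have -> : CF x g - CF f (gns_act a g) = CF x h - CF f (gns_act a h).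
  rewrite [gns_act a h](linearB (gns_rep a)) !formBr opprB.
  suff -> : CF x (completion_of gns_form v) =
      CF f (gns_rep a (completion_of gns_form v)).
    by rewrite addrA subrK.
  rewrite [gns_rep _ _]gns_act_of.
  by rewrite [LHS]completion_inner_of [RHS]completion_inner_of /= starK.
rewrite (le_trans (ler_normcD _ _))// normc_opp.
rewrite (le_trans (lerD (normc_form_le _ _ _) (normc_form_le _ _ _)))//.
have h1 : cp x * cp h <= cp x * (e / K) by exact: ler_wpM2l.
have h2 : cp f * cp (gns_act a h) <= cp f * cnorm a * (e / K).
  rewrite -mulrA ler_wpM2l// (le_trans (gns_act_seminorm _ _))//.
  exact: ler_wpM2l.
rewrite (le_trans (lerD h1 h2))// -mulrDl mulrCA ler_piMr ?(ltW e0)//.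
by rewrite ler_pdivrMr// mul1r /K; lra.
Qed.

Lemma gns_rep_is_representation : is_representation gns_rep.
Proof.
split=> [a|c a b f|a b f|f|a f g].
- exact: gns_rep_continuous.
- apply: completionE => x.
  rewrite completion_funD completion_funZ /= starD starZ mulrDl -scalerAl.
  by rewrite completion_funDr completion_funZr conjCK.
- by apply: completionE => x; rewrite /= starM mulrA.
- by apply: completionE => x; rewrite /= star1 mul1r.
- exact: gns_act_adjoint.
Qed.

Lemma gns_rep_cyclic : is_gns w gns_rep (completion_of gns_form 1).
Proof.
split=> [|a|O [f Of] oO]; first exact: gns_rep_is_representation.
  rewrite [gns_rep _ _]gns_act_of.
  rewrite [RHS]completion_inner_of mulr1.
  by rewrite -[RHS]/(w (star 1 * a)) star1 mul1r.
have /nbhs_ballP [e /= e0 he] : nbhs f O by exact: open_nbhs_nbhs.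
have e0' : 0 < Re e by move: e0; rewrite ltcE /= => /andP[].
have [v hv] := completion_dense_of f (divr_gt0 e0' (ltr0Sn _ 1)).
exists (completion_of gns_form v); split.
  apply: he; rewrite -ball_normE /= (le_lt_trans hv)//.
  by rewrite [ltRHS](complex_ge0 (ltW e0)) ltcR; lra.
by exists v => //; rewrite [gns_rep _ _]gns_act_of mulr1.
Qed.

End State.

(** One GNS triple serves both states, with the identity as intertwiner. *)
Lemma state_equiv_eq (R : realType) (A : cstarAlgType R) (w1 w2 : {scalar A}) :
  is_state w1 -> w1 =1 w2 -> state_equiv w1 w2.
Proof.
move=> h1 h12; have [r wE d] := gns_rep_cyclic h1.
exists (completion (gns_form h1)), (gns_rep h1), (completion_of (gns_form h1) 1).
exists (completion (gns_form h1)), (gns_rep h1), (completion_of (gns_form h1) 1).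
split=> //; first by split=> // a; rewrite -h12.
by exists idfun; split=> //; exists idfun.
Qed.

(** * Bounded functionals on a C*-algebra *)

Section BoundedFunctional.
Variables (R : realType) (A : cstarAlgType R).
Local Notation C := R[i].
Implicit Types (psi : A -> C) (a b : A).

Definition bounded_functional psi :=
  scalar psi /\ exists K : R, forall a, normc (psi a) <= K * cnorm a.

Lemma bounded_functional_scalar psi : bounded_functional psi ->
  exists F : {scalar A}, psi = F.
Proof.
move=> [lin _].
pose F : {scalar A} := HB.pack psi (GRing.isLinear.Build C A C *%R psi lin).
by exists F.
Qed.

Lemma bounded_functional_bound psi : bounded_functional psi ->
  exists2 K : R, 0 < K & forall a, normc (psi a) <= K * cnorm a.
Proof.
move=> [_ [K hK]]; have K0 := normr_ge0 K; exists (`|K| + 1); first by lra.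
move=> a; rewrite (le_trans (hK a))// ler_wpM2r ?cnorm_ge0//.
by have := ler_norm K; lra.
Qed.

Lemma bounded_functional_mull psi a : bounded_functional psi ->
  bounded_functional (fun x => psi (a * x)).
Proof.
move=> h; have [K K0 hK] := bounded_functional_bound h; have [lin _] := h.
split=> [c x y|]; first by rewrite mulrDr -scalerAr lin.
exists (K * cnorm a) => x; rewrite (le_trans (hK _))// -mulrA ler_wpM2l ?(ltW K0)//.
exact: ler_cnormM.
Qed.

Lemma bounded_functional_mulr psi a : bounded_functional psi ->
  bounded_functional (fun x => psi (x * a)).
Proof.
move=> h; have [K K0 hK] := bounded_functional_bound h; have [lin _] := h.
split=> [c x y|]; first by rewrite mulrDl -scalerAl lin.
exists (K * cnorm a) => x.
rewrite (le_trans (hK _))// -mulrA ler_wpM2l ?(ltW K0)// [cnorm a * _]mulrC.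
exact: ler_cnormM.
Qed.

Lemma bounded_functional_star psi : bounded_functional psi ->
  bounded_functional (fun x => Num.conj (psi (star x))).
Proof.
move=> [lin [K hK]]; split=> [c x y|].
  by rewrite starD starZ lin conjCD conjCM conjCK.
by exists K => a; rewrite normc_conj -(cnorm_star a).
Qed.

End BoundedFunctional.

(** * Words in isometries with orthogonal ranges *)

Section Words.
Variables (R : realType) (A : cstarAlgType R) (I : finType) (g : I -> A).
Hypothesis g_isom : forall i j, star (g i) * g j = (i == j)%:R.
Local Notation C := R[i].
Implicit Types (J K L M : seq I) (psi : A -> C).

Definition word J : A := \prod_(i <- J) g i.

Lemma word_cons i J : word (i :: J) = g i * word J.
Proof. by rewrite /word big_cons. Qed.

Lemma word_cat J K : word (J ++ K) = word J * word K.
Proof. by rewrite /word big_cat. Qed.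

Lemma word_nil : word [::] = 1.
Proof. by rewrite /word big_nil. Qed.

(** Equal leading letters cancel and distinct ones give 0, until one of the words is exhausted. *)
Lemma word_star_word K L :
  star (word K) * word L = 0 \/ (exists M, star (word K) * word L = word M) \/
  exists M, star (word K) * word L = star (word M).
Proof.
elim: K L => [L|k K IH [|l L]].
- by right; left; exists L; rewrite word_nil star1 mul1r.
- by right; right; exists (k :: K); rewrite word_nil mulr1.
- rewrite !word_cons starM -mulrA [star (g k) * _]mulrA g_isom.
  case: eqP => _; last by left; rewrite mul0r mulr0.
  by rewrite mul1r; exact: IH.
Qed.

Definition kills_words psi := forall J K, psi (word J * star (word K)) = 0.

Lemma kills_words_mul psi : bounded_functional psi -> kills_words psi ->
  forall J K L M, psi (word J * star (word K) * (word L * star (word M))) = 0.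
Proof.
move=> /bounded_functional_scalar[F ->] h J K L M.
rewrite -mulrA [star _ * (_ * _)]mulrA.
have [->|[[N ->]|[N ->]]] := word_star_word K L.
- by rewrite mul0r mulr0 linear0.
- by rewrite mulrA -word_cat h.
- by rewrite -starM -word_cat h.
Qed.

Hypothesis g_generates : forall S : set A, norm_closed S ->
  GRing.subalg_closed (mem S) -> (forall a, S a -> S (star a)) ->
  (forall i, S (g i)) -> S = setT.

(* The elements annihilated by every bounded functional that vanishes on the  *)
(* words form a closed *-subalgebra: no density argument is needed.           *)
Lemma kills_words_eq0 psi : bounded_functional psi -> kills_words psi ->
  forall a, psi a = 0.
Proof.
pose S : set A := [set a | forall phi, bounded_functional phi ->
  kills_words phi -> phi a = 0].
suff ST : S = setT.
  by move=> hpsi kpsi a; have Sa : S a by [rewrite ST]; exact: Sa.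
apply: g_generates.
- move=> u l Su /cnorm_cvgP ul phi hphi kphi.
  have [K K0 hK] := bounded_functional_bound hphi.
  apply: normc_small_eq0 => e e0; have [N /(_ N (leqnn N)) hN] := ul _ (divr_gt0 e0 K0).
  have -> : phi l = - phi (u N - l).
    have uN := Su N _ hphi kphi.
    have [F FE] := bounded_functional_scalar hphi.
    by rewrite FE linearB/= -FE uN sub0r opprK.
  rewrite normc_opp (le_trans (hK _))//.
  by rewrite mulrC -ler_pdivlMr.
- split.
  + apply/mem_set => phi _ kphi.
    by have := kphi [::] [::]; rewrite word_nil star1 mulr1.
  + move=> c x y /set_mem Sx /set_mem Sy; apply/mem_set => phi hphi kphi.
    by have [lin _] := hphi; rewrite lin Sx// Sy// mulr0 addr0.
  + move=> x y /set_mem Sx /set_mem Sy; apply/mem_set => phi hphi kphi.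
    (* The functional phi(. y) kills words because each phi(s_J star(s_K) .) kills words and [y] is
       in [S]. *)
    apply: (Sx _ (bounded_functional_mulr y hphi)) => J K.
    apply: (Sy _ (bounded_functional_mull _ hphi)) => L M.
    exact: kills_words_mul.
- move=> a Sa phi hphi kphi.
  have := Sa _ (bounded_functional_star hphi).
  rewrite -[RHS](conjC0 C) => h; apply: (can_inj (@conjCK C)); apply: h => J K.
  by rewrite starM starK kphi conjC0.
- move=> i phi _ kphi.
  by have := kphi [:: i] [::]; rewrite word_nil word_cons star1 word_nil !mulr1.
Qed.

End Words.

(** * The eigenvalue relations determine a functional *)

Section Vanishing.
Variables (R : realType) (A : cstarAlgType R) (I : finType).
Variable g : option I -> A.
Hypothesis g_isom : forall i j, star (g i) * g j = (i == j)%:R.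
Hypothesis g_sum : \sum_i g (Some i) * star (g (Some i)) + g None * star (g None) = 1.
Hypothesis g_generates : forall S : set A, norm_closed S ->
  GRing.subalg_closed (mem S) -> (forall a, S a -> S (star a)) ->
  (forall i, S (g i)) -> S = setT.
Local Notation C := R[i].
Local Notation t := (g None).
Local Notation l i := (g (Some i)).
Local Notation v r i := (t ^+ r * l i).

(** Every word factors into pieces v_(r,i) followed by a power of t. The pieces come out as scalars,
    leaving the values at t^p star(t^q), which are shown to be 0. *)
Lemma progression_vanish (z y : nat -> I -> C) (psi : A -> C) :
  bounded_functional psi ->
  (forall r i a, psi (a * star (v r i)) = z r i * psi a) ->
  (forall r i a, psi (v r i * a) = Num.conj (y r i) * psi a) ->
  (forall e : R, 0 < e -> exists N : nat, forall p q, (N <= p)%N -> (N <= q)%N ->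
     normc (psi (t ^+ p * star (t ^+ q))) <= e) ->
  psi 1 = 0 -> forall a, psi a = 0.
Proof.
move=> hpsi hz hy htail psi1.
have [F FE] := bounded_functional_scalar hpsi.
(* Inserting [g_sum] between t^p and star(t^q) adds terms z conj(y) psi(1) = 0, so values are
   constant along diagonals. *)
have diag p q N : psi (t ^+ p * star (t ^+ q)) =
    psi (t ^+ (N + p) * star (t ^+ (N + q))).
  elim: N p q => [|N IH] p q //.
  rewrite addSnnS addSnnS -IH !exprSr.
  rewrite -{1}[t ^+ p](mulr1) -g_sum mulrDr mulrDl.
  rewrite FE linearD/= -FE starM !mulrA.
  rewrite big_distrr/= big_distrl/= FE linear_sum/= -FE big1 ?add0r// => i _.
  rewrite mulrA -mulrA -starM hz -[v _ _]mulr1 hy psi1 !mulr0//.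
have tt p q : psi (t ^+ p * star (t ^+ q)) = 0.
  apply: normc_small_eq0 => e /htail [N hN]; rewrite (diag p q N).
  by apply: hN; exact: leq_addr.
apply: (kills_words_eq0 g_isom g_generates hpsi).
(* The power t^q accumulates the leading letters t of [K] until some l_i completes a v_(q,i). *)
have right K : forall p q, psi (t ^+ p * star (word g K) * star (t ^+ q)) = 0.
  move=> p; elim: K => [|[i|] K IH] q.
  - by rewrite word_nil star1 mulr1 tt.
  - rewrite word_cons starM -!mulrA -starM mulrA hz.
    by have := IH 0; rewrite expr0 star1 mulr1 => ->; rewrite mulr0.
  - by rewrite word_cons starM -!mulrA -starM -exprSr mulrA IH.
have left K J : forall p, psi (t ^+ p * word g J * star (word g K)) = 0.
  elim: J => [|[i|] J IH] p.
  - by have := right K p 0; rewrite word_nil mulr1 expr0 star1 mulr1.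
  - rewrite word_cons !mulrA -mulrA hy.
    by have := IH 0; rewrite expr0 mul1r => ->; rewrite mulr0.
  - by rewrite word_cons !mulrA -exprSr IH.
by move=> J K; have := left K J 0; rewrite expr0 mul1r.
Qed.

End Vanishing.

(** * Equality in Cauchy-Schwarz for a state *)

Section StateEigen.
Variables (R : realType) (A : cstarAlgType R) (w : {scalar A}).
Hypothesis hw : is_state w.
Local Notation C := R[i].
Implicit Types (a v : A) (c : C).

(** Cauchy-Schwarz for the GNS form at 1 and star(v). *)
Lemma state_ge_sqr v c : w v = Num.conj c -> normc c ^+ 2 <= Re (w (v * star v)).
Proof.
move=> wv; have := sqr_normc_form_le (gns_form hw) 1 (star v).
rewrite !gns_formE starK star1 !mulr1 wv normc_conj.
by have [_ ->] := hw; rewrite mul1r.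
Qed.

Lemma state_mul_star_le a b (e : R) : 0 <= e -> Re (w (a * star a)) <= e ^+ 2 ->
  Re (w (b * star b)) <= 1 -> normc (w (a * star b)) <= e.
Proof.
move=> e0 ha hb; rewrite -(@ler_pXn2r _ 2)// ?nnegrE ?normc_ge0//.
have := sqr_normc_form_le (gns_form hw) (star b) (star a).
rewrite !gns_formE !starK => /le_trans; apply.
rewrite mulrC -[leRHS]mulr1; apply: ler_pM => //; apply: Re_ge0.
  by rewrite -{1}(starK a); have [h _] := hw; exact: h.
by rewrite -{1}(starK b); have [h _] := hw; exact: h.
Qed.

(* The equality case of Cauchy-Schwarz: [star v] acts on the cyclic vector as *)
(* the scalar [c].                                                            *)
Lemma state_eigen_seminorm v c : w v = Num.conj c ->
  Re (w (v * star v)) <= normc c ^+ 2 ->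
  seminorm (gns_form hw) (star v - c *: 1) = 0.
Proof.
move=> wv wvv; apply/eqP; rewrite -sqrf_eq0; apply/eqP/le_anti.
rewrite sqr_ge0 andbT sqr_seminorm gns_formE starB starK starZ star1.
rewrite mulrBl !mulrBr -!scalerAl -!scalerAr !mulr1 !mul1r.
rewrite !linearB/= !linearZ/= (state_star hw) wv conjCK.
have [_ ->] := hw.
by rewrite mulr1 opprK addNr addr0 mul_conj_normc subr_le0.
Qed.

(** The null vector star(v) - c is orthogonal to star(a). *)
Lemma state_eigen_mulr v c : w v = Num.conj c ->
  Re (w (v * star v)) <= normc c ^+ 2 ->
  forall a, w (a * star v) = c * w a.
Proof.
move=> wv wvv a; have d0 := state_eigen_seminorm wv wvv.
have := normc_form_le (gns_form hw) (star v - c *: 1) (star a).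
rewrite d0 mul0r => /normc_le0_eq0; rewrite gns_formE starK mulrBr -scalerAr mulr1.
by rewrite linearB/= linearZ/= => /eqP; rewrite subr_eq0 => /eqP.
Qed.

Lemma state_eigen_mull v c : w v = Num.conj c ->
  Re (w (v * star v)) <= normc c ^+ 2 ->
  forall a, w (v * a) = Num.conj c * w a.
Proof.
move=> wv wvv a; rewrite -[v * a]starK (state_star hw) starM.
by rewrite (state_eigen_mulr wv wvv) conjCM -(state_star hw) starK.
Qed.

Lemma state_bounded : bounded_functional w.
Proof.
split; first exact: linearP.
exists 1 => a; rewrite mul1r -(@ler_pXn2r _ 2)// ?nnegrE ?normc_ge0 ?cnorm_ge0//.
have := sqr_normc_form_le (gns_form hw) a 1.
rewrite !gns_formE !star1 !mul1r; have [_ ->] := hw; rewrite mulr1 => /le_trans.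
by apply; exact: state_sqr_le.
Qed.

End StateEigen.

(** * States with prescribed values on a geometric progression *)

Section Progression.
Variables (R : realType) (A : cstarAlgType R) (I : finType).
Variable g : option I -> A.
Hypothesis g_isom : forall i j, star (g i) * g j = (i == j)%:R.
Hypothesis g_sum : \sum_i g (Some i) * star (g (Some i)) + g None * star (g None) = 1.
Local Notation C := R[i].
Local Notation t := (g None).
Local Notation v r i := (t ^+ r * g (Some i)).

(** Inductively, [g_sum] splits the remainder t^N star(t^N) into the row [N] and the next
    remainder. *)
Lemma progression_sum N :
  \sum_(r < N) \sum_i v r i * star (v r i) + t ^+ N * star (t ^+ N) = 1.
Proof.
elim: N => [|N IH]; first by rewrite big_ord0 expr0 star1 mulr1 add0r.
rewrite big_ord_recr/= -[RHS]IH -addrA; congr (_ + _).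
rewrite -[X in _ = X * _]mulr1 -g_sum mulrDr mulrDl big_distrr/= big_distrl/=.
congr (_ + _); first by apply: eq_bigr => i _; rewrite starM !mulrA.
by rewrite exprSr starM !mulrA.
Qed.

Definition sqr_sum (z : nat -> I -> C) N : R :=
  \sum_(r < N) \sum_i normc (z r i) ^+ 2.

(** For values of a state, [sqr_sum_shift_le1] bounds the partial sums by 1, so this says that the
    squares sum to 1. *)
Definition unit_progression (z : nat -> I -> C) :=
  forall e : R, 0 < e -> exists N, 1 - e <= sqr_sum z N.

Lemma sqr_sum_le z N M : (N <= M)%N -> sqr_sum z N <= sqr_sum z M.
Proof.
move=> /subnK <-; elim: (M - N)%N => [//|k IH].
rewrite addSn /sqr_sum big_ord_recr/= (le_trans IH)// lerDl.
by apply: sumr_ge0 => i _; exact: sqr_ge0.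
Qed.

Variables (w : {scalar A}) (z : nat -> I -> C).
Hypothesis hw : is_state w.
Hypothesis wz : forall r i, w (v r i) = Num.conj (z r i).
Local Notation W a := (Re (w (a * star a))).

Lemma state_progression_sum N :
  \sum_(r < N) \sum_i W (v r i) + W (t ^+ N) = 1.
Proof.
have [_ w1] := hw; have := congr1 (fun a => Re (w a)) (progression_sum N).
rewrite w1 linearD/= ReD/= => <-; congr (_ + _).
rewrite linear_sum/= raddf_sum; apply: eq_bigr => r _.
by rewrite linear_sum/= raddf_sum.
Qed.

Lemma state_mul_star_ge0 a : 0 <= W a.
Proof. by have [h _] := hw; apply: Re_ge0; rewrite -{1}(starK a) h. Qed.

Lemma sqr_sum_shift_le1 N : sqr_sum z N + W (t ^+ N) <= 1.
Proof.
rewrite -(state_progression_sum N) lerD2r; apply: ler_sum => r _.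
by apply: ler_sum => i _; exact: state_ge_sqr.
Qed.

Lemma state_shift_le N : W (t ^+ N) <= 1 - sqr_sum z N.
Proof. by rewrite lerBrDl sqr_sum_shift_le1. Qed.

Hypothesis hz : unit_progression z.

(** The defects w(v star(v)) - |z|^2 are nonnegative, and their sum over [N] rows is at most [e] for
    large [N]; hence each is. *)
Lemma progression_eigen r i : W (v r i) <= normc (z r i) ^+ 2.
Proof.
apply/ler_addgt0Pr => e /hz [N0 hN0].
pose N := maxn N0 r.+1.
have rN : (r < N)%N by rewrite leq_max leqnn orbT.
have hN : 1 - e <= sqr_sum z N.
  by rewrite (le_trans hN0)// sqr_sum_le// leq_maxl.
have tN := state_mul_star_ge0 (t ^+ N).
have : \sum_(r < N) \sum_i (W (v r i) - normc (z r i) ^+ 2) <= e.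
  have -> : \sum_(r < N) \sum_i (W (v r i) - normc (z r i) ^+ 2) =
      1 - W (t ^+ N) - sqr_sum z N.
    rewrite -(state_progression_sum N) addrK /sqr_sum -sumrB.
    by apply: eq_bigr => k _; rewrite sumrB.
  by lra.
have d0 k j : 0 <= W (v k j) - normc (z k j) ^+ 2.
  by rewrite subr_ge0; exact: state_ge_sqr.
rewrite (bigD1 (Ordinal rN))//= (bigD1 i)//= -addrA.
have : 0 <= \sum_(j | j != i) (W (v r j) - normc (z r j) ^+ 2) +
    \sum_(k < N | k != Ordinal rN) \sum_j (W (v k j) - normc (z k j) ^+ 2).
  by apply: addr_ge0; [|apply: sumr_ge0 => k _]; apply: sumr_ge0.
by move: (_ + \sum_(k < N | _) _) => X; lra.
Qed.

Lemma progression_mulr r i a : w (a * star (v r i)) = z r i * w a.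
Proof. exact: (state_eigen_mulr hw) (progression_eigen r i) a. Qed.

Lemma progression_mull r i a : w (v r i * a) = Num.conj (z r i) * w a.
Proof. exact: (state_eigen_mull hw) (progression_eigen r i) a. Qed.

Lemma progression_tail e : 0 < e ->
  exists N : nat, forall p, (N <= p)%N -> W (t ^+ p) <= e.
Proof.
move=> /hz [N hN]; exists N => p Np.
by have := state_shift_le p; have := sqr_sum_le z Np; lra.
Qed.

Lemma state_shift_le1 p : W (t ^+ p) <= 1.
Proof.
have := state_shift_le p; have := sqr_sum_le z (leq0n p).
by rewrite {1}/sqr_sum big_ord0; lra.
Qed.

End Progression.

(** Closed by [Defined], so that the form converts to [inner]. *)
Definition inner_form (R : realType) (H : hilbertType R) : psd_form H.
Proof.
apply: (@PsdForm R H (@inner R H)) => [c u v x|u v|u].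
- by rewrite linearPl.
- by rewrite (hermC (@inner R H)) /= expr0 mul1r.
- by rewrite inner_norm exprn_ge0.
Defined.

(** * Cyclic vectors of arbitrary GNS triples *)

Section GNS.
Variables (R : realType) (A : cstarAlgType R) (w : {scalar A}) (H : hilbertType R).
Variables (pi : A -> {linear H -> H}) (Omega : H).
Hypotheses (hw : is_state w) (gns : is_gns w pi Omega).
Local Notation B := (inner_form H).
Local Notation C := R[i].

Lemma inner_seminorm_eq0 (x : H) : seminorm B x = 0 -> x = 0.
Proof.
move=> x0; apply/eqP; rewrite -normr_eq0 -sqrf_eq0 -inner_norm.
by rewrite -[inner x x]/(B x x) form_seminorm x0 expr0n.
Qed.

Lemma gns_repD a b x : pi (a + b) x = pi a x + pi b x.
Proof.
by have [[_ piL _ _ _] _ _] := gns; rewrite -[a]scale1r piL !scale1r.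
Qed.

Lemma gns_repZ (c : C) a x : pi (c *: a) x = c *: pi a x.
Proof.
have [[_ piL _ _ _] _ _] := gns; rewrite -[c *: a]addr0 piL.
have := piL (-1) 0 0 x; rewrite scaler0 addr0 scaleN1r addNr => ->.
by rewrite addr0.
Qed.

Lemma gns_seminorm a : seminorm B (pi a Omega) = seminorm (gns_form hw) a.
Proof.
have [[_ _ piM _ piS] wE _] := gns.
by rewrite /seminorm gns_formE wE piM piS.
Qed.

Lemma gns_eigen v (c : C) : w v = Num.conj c ->
  Re (w (v * star v)) <= normc c ^+ 2 -> pi (star v) Omega = c *: Omega.
Proof.
have [[_ _ _ pi1 _] _ _] := gns.
move=> wv wvv; have d0 := state_eigen_seminorm hw wv wvv.
apply/eqP; rewrite -subr_eq0; apply/eqP/inner_seminorm_eq0.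
by rewrite -d0 -gns_seminorm -!scaleNr gns_repD gns_repZ pi1.
Qed.

(** If x is nonzero, density gives u = pi(a) Omega with |x - u| < |x|, but orthogonality gives |x|^2
    = <x - u, x> <= |x - u| |x|. *)
Lemma gns_cyclic_orthogonal (x : H) : (forall a, inner (pi a Omega) x = 0) -> x = 0.
Proof.
have [_ _ dn] := gns; move=> hx; apply/eqP/negP => /negP x0.
have nx : 0 < `|x| by rewrite normr_gt0.
have [|y [/= hb [a _ ea]]] := dn _ _ (ball_open x `|x|).
  by exists x; exact: ballxx.
move: hb; rewrite -ball_normE /= -ea => hb.
have : normc (B (x - pi a Omega) x) <= _ := normc_form_le _ _ _.
rewrite formBl [B (pi a Omega) x]hx subr0 form_seminorm normc_real.
rewrite ger0_norm ?sqr_ge0// expr2.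
have nE (u : H) : `|u| = (seminorm B u)%:C%C.
  apply/eqP; rewrite -(@eqrXn2 _ 2)// ?ler0c ?seminorm_ge0//.
  by rewrite -inner_norm -rmorphXn; apply/eqP; exact: (form_seminorm B u).
move: nx hb; rewrite !nE !ltcR => nx hb.
by rewrite ler_pM2r// leNgt hb.
Qed.

End GNS.

(** * Equivalence of progression states *)

Section Equivalence.
Variables (R : realType) (A : cstarAlgType R) (I : finType).
Variable g : option I -> A.
Hypothesis g_isom : forall i j, star (g i) * g j = (i == j)%:R.
Hypothesis g_sum : \sum_i g (Some i) * star (g (Some i)) + g None * star (g None) = 1.
Hypothesis g_generates : forall S : set A, norm_closed S ->
  GRing.subalg_closed (mem S) -> (forall a, S a -> S (star a)) ->
  (forall i, S (g i)) -> S = setT.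
Local Notation C := R[i].
Local Notation t := (g None).
Local Notation v r i := (t ^+ r * g (Some i)).
Variables (w1 w2 : {scalar A}) (z1 z2 : nat -> I -> C).
Hypotheses (hw1 : is_state w1) (hw2 : is_state w2).
Hypothesis wz1 : forall r i, w1 (v r i) = Num.conj (z1 r i).
Hypothesis wz2 : forall r i, w2 (v r i) = Num.conj (z2 r i).
Hypotheses (hz1 : unit_progression z1) (hz2 : unit_progression z2).

Lemma progression_state_unique : (forall r i, z1 r i = z2 r i) -> w1 =1 w2.
Proof.
move=> z12 a; apply/eqP; rewrite -subr_eq0; apply/eqP; move: a.
have [lin1 _] := state_bounded hw1; have [lin2 _] := state_bounded hw2.
have [K1 K10 hK1] := bounded_functional_bound (state_bounded hw1).
have [K2 K20 hK2] := bounded_functional_bound (state_bounded hw2).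
apply: (progression_vanish g_isom g_sum g_generates (z := z1) (y := z2)).
- split; first by move=> c a b; rewrite lin1 lin2; ring.
  exists (K1 + K2) => a; rewrite (le_trans (ler_normcD _ _))// normc_opp mulrDl.
  exact: lerD.
- move=> r i a; rewrite (progression_mulr g_sum hw1 wz1 hz1).
  by rewrite (progression_mulr g_sum hw2 wz2 hz2) z12 mulrBr.
- move=> r i a; rewrite (progression_mull g_sum hw1 wz1 hz1).
  by rewrite (progression_mull g_sum hw2 wz2 hz2) z12 mulrBr.
- move=> e e0; have e4 : 0 < (e / 2) ^+ 2 by rewrite exprn_gt0//; lra.
  have [N1 hN1] := progression_tail g_sum hw1 wz1 hz1 e4.
  have [N2 hN2] := progression_tail g_sum hw2 wz2 hz2 e4.
  exists (maxn N1 N2) => p q; rewrite !geq_max => /andP[p1 p2] /andP[q1 q2].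
  rewrite (le_trans (ler_normcD _ _))// normc_opp [leRHS]splitr.
  apply: lerD; apply: state_mul_star_le => //; try lra.
  + exact: hN1.
  + exact: (state_shift_le1 g_sum hw1 wz1).
  + exact: hN2.
  + exact: (state_shift_le1 g_sum hw2 wz2).
- have [[_ ->] [_ ->]] := (hw1, hw2); exact: subrr.
Qed.

Section Inequivalence.
Variables (H1 H2 : hilbertType R).
Variables (pi1 : A -> {linear H1 -> H1}) (Omega1 : H1).
Variables (pi2 : A -> {linear H2 -> H2}) (Omega2 : H2).
Hypotheses (gns1 : is_gns w1 pi1 Omega1) (gns2 : is_gns w2 pi2 Omega2).
Variable U : {linear H1 -> H2}.
Hypothesis U_isometry : forall x y, inner (U x) (U y) = inner x y.
Hypothesis U_intertwines : forall a x, U (pi1 a x) = pi2 a (U x).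

Definition transition (a : A) : C := inner_form H2 (U (pi1 a Omega1)) Omega2.

Lemma seminorm_isometry x : seminorm (inner_form H2) (U x) = seminorm (inner_form H1) x.
Proof. by rewrite /seminorm /= U_isometry. Qed.

Lemma transition_le a b :
  normc (inner_form H2 (U (pi1 a Omega1)) (pi2 b Omega2)) <=
  seminorm (gns_form hw1) a * seminorm (gns_form hw2) b.
Proof.
apply: le_trans (normc_form_le _ _ _) _.
by rewrite seminorm_isometry (gns_seminorm hw1 gns1) (gns_seminorm hw2 gns2).
Qed.

(** As U intertwines, a left factor moves to the second cyclic vector, where the eigenvalues [z2]
    apply. *)
Lemma transition_mull a b :
  transition (a * b) = inner_form H2 (U (pi1 b Omega1)) (pi2 (star a) Omega2).
Proof.
have [[_ _ piM1 _ _] _ _] := gns1; have [[_ _ _ _ piS] _ _] := gns2.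
by rewrite /transition piM1 U_intertwines /= -piS starK.
Qed.

Lemma transition_bounded : bounded_functional transition.
Proof.
split=> [c a b|].
  rewrite /transition (gns_repD gns1) (gns_repZ gns1) linearP.
  exact: form_linear.
exists 1 => a; rewrite mul1r.
have [[_ _ _ piid _] _ _] := gns2.
rewrite /transition -(piid Omega2).
rewrite (le_trans (transition_le _ _))// -(@ler_pXn2r _ 2)// ?nnegrE ?mulr_ge0
  ?seminorm_ge0 ?cnorm_ge0//.
rewrite exprMn !sqr_seminorm !gns_formE star1 mul1r.
have [_ ->] := hw2; rewrite /= mulr1; exact: state_sqr_le.
Qed.

Lemma transition_eigen_mulr r i a :
  transition (a * star (v r i)) = z1 r i * transition a.
Proof.
have [[_ _ piM1 _ _] _ _] := gns1.
rewrite /transition piM1 (gns_eigen hw1 gns1 (wz1 r i)).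
  by rewrite !linearZ; exact: formZl.
exact: (progression_eigen g_sum hw1 wz1 hz1).
Qed.

Lemma transition_eigen_mull r i a :
  transition (v r i * a) = Num.conj (z2 r i) * transition a.
Proof.
rewrite transition_mull (gns_eigen hw2 gns2 (wz2 r i)) ?formZr//.
exact: (progression_eigen g_sum hw2 wz2 hz2).
Qed.

Lemma transition_tail e : 0 < e -> exists N : nat, forall p q,
  (N <= p)%N -> (N <= q)%N -> normc (transition (t ^+ p * star (t ^+ q))) <= e.
Proof.
move=> e0; have [N hN] := progression_tail g_sum hw1 wz1 hz1 (exprn_gt0 2 e0).
exists N => p q _ /hN hq; rewrite transition_mull.
rewrite (le_trans (transition_le _ _))// -(@ler_pXn2r _ 2)// ?nnegrE ?mulr_ge0
  ?seminorm_ge0 ?(ltW e0)//.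
rewrite exprMn !sqr_seminorm !gns_formE !starK -[leRHS]mulr1.
apply: ler_pM => //; rewrite ?(state_mul_star_ge0 hw1) ?(state_mul_star_ge0 hw2)//.
exact: (state_shift_le1 g_sum hw2 wz2).
Qed.

(** Let S be the partial sum of z1 conj(z2). Then (1 - S) phi(1) is a tail that tends to 0, while
    Re(1 - S) >= d/2. *)
Lemma transition1 r0 i0 : z1 r0 i0 != z2 r0 i0 -> transition 1 = 0.
Proof.
move=> z12; set d := normc (z1 r0 i0 - z2 r0 i0) ^+ 2.
have d0 : 0 < d.
  rewrite exprn_gt0// lt0r normc_ge0 andbT.
  apply: contra z12 => /eqP h; rewrite -subr_eq0; apply/eqP.
  by apply: normc_le0_eq0; rewrite h.
apply: normc_small_eq0 => e e0.
have [N0 hN0] := transition_tail (mulr_gt0 e0 (divr_gt0 d0 (ltr0Sn _ 1))).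
pose N := maxn N0 r0.+1.
have rN : (r0 < N)%N by rewrite leq_max leqnn orbT.
have {hN0} hN := hN0 N N (leq_maxl _ _) (leq_maxl _ _).
pose S := \sum_(r < N) \sum_i z1 r i * Num.conj (z2 r i).
have [F FE] := bounded_functional_scalar transition_bounded.
(* Evaluate phi at the decomposition of 1 from [progression_sum]. *)
have E : (1 - S) * transition 1 = transition (t ^+ N * star (t ^+ N)).
  rewrite mulrBl mul1r -{1}(progression_sum g_sum N) {1}FE linearD/= -FE.
  rewrite addrAC -[RHS]add0r; congr (_ + _); apply/eqP; rewrite subr_eq0; apply/eqP.
  rewrite FE linear_sum/= mulr_suml; apply: eq_bigr => r _.
  rewrite linear_sum/= mulr_suml; apply: eq_bigr => i _.
  rewrite -FE transition_eigen_mulr -[v r i]mulr1 transition_eigen_mull.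
  by rewrite mulrA.
(* Both partial sums of squares are at most 1, so the sum of |z1 - z2|^2, which contains d, is at
   most 2 - 2 Re S. *)
have hS : d / 2 <= Re (1 - S).
  have dE (x y : C) : normc (x - y) ^+ 2 =
      normc x ^+ 2 + normc y ^+ 2 - 2 * Re (x * Num.conj y).
    have nE (u : C) : normc u ^+ 2 = Re u ^+ 2 + Im u ^+ 2.
      by case: u => a b; rewrite /= sqr_sqrtr// addr_ge0// sqr_ge0.
    by rewrite !nE; case: x y => [a b] [c f] /=; ring.
  have h1 : d <= \sum_(r < N) \sum_i normc (z1 r i - z2 r i) ^+ 2.
    rewrite (bigD1 (Ordinal rN))//= (bigD1 i0)//= -addrA lerDl addr_ge0//.
      by apply: sumr_ge0 => i _; exact: sqr_ge0.
    by apply: sumr_ge0 => k _; apply: sumr_ge0 => i _; exact: sqr_ge0.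
  have h2 : \sum_(r < N) \sum_i normc (z1 r i - z2 r i) ^+ 2 =
      sqr_sum z1 N + sqr_sum z2 N - 2 * Re S.
    rewrite /sqr_sum /S raddf_sum/= mulr_sumr -big_split/= -sumrB.
    apply: eq_bigr => r _; rewrite raddf_sum/= mulr_sumr -big_split/= -sumrB.
    by apply: eq_bigr => i _; exact: dE.
  have := sqr_sum_shift_le1 g_sum hw1 wz1 N; have := sqr_sum_shift_le1 g_sum hw2 wz2 N.
  have := state_mul_star_ge0 hw1 (t ^+ N); have := state_mul_star_ge0 hw2 (t ^+ N).
  rewrite raddfB/=; lra.
have h : d / 2 * normc (transition 1) <= d / 2 * e.
  rewrite [leRHS]mulrC; apply: le_trans hN; rewrite -E normc_mul.
  rewrite ler_wpM2r ?normc_ge0// (le_trans hS)//.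
  exact: le_trans (ler_norm _) (ler_Re_normc _).
by rewrite -(ler_pM2l (divr_gt0 d0 (ltr0Sn _ 1))).
Qed.

Lemma transition_eq0 r0 i0 : z1 r0 i0 != z2 r0 i0 -> forall a, transition a = 0.
Proof.
move=> z12; apply: (progression_vanish g_isom g_sum g_generates).
- exact: transition_bounded.
- exact: transition_eigen_mulr.
- exact: transition_eigen_mull.
- exact: transition_tail.
- exact: transition1 z12.
Qed.

End Inequivalence.

Lemma progression_state_equiv :
  state_equiv w1 w2 <-> forall r i, z1 r i = z2 r i.
Proof.
split=> [|z12]; last first.
  by apply: state_equiv_eq => //; exact: progression_state_unique.
move=> [H1 [pi1 [xi1 [H2 [pi2 [xi2 [gns1 gns2 [U [[V UK VK] Uiso Uint]]]]]]]]] r i.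
apply/eqP/negP => /negP z12.
have T0 := transition_eq0 gns1 gns2 Uiso Uint z12.
(* [transition a] equals <pi1(a) xi1, V xi2> for the inverse V of U. *)
have V0 : V xi2 = 0.
  apply: (gns_cyclic_orthogonal gns1) => a.
  by rewrite -Uiso VK; exact: T0.
have [_ w2E _] := gns2; have [_ w21] := hw2; have [[_ _ _ pi2id _] _ _] := gns2.
have : w2 1 = 0.
  by rewrite w2E pi2id -(VK xi2) V0 linear0; exact: (form0l (inner_form H2)).
by rewrite w21 => /eqP; rewrite oner_eq0.
Qed.

End Equivalence.

Lemma sum_blocks (V : nmodType) (d N : nat) (F : nat -> V) :
  \sum_(r < N) \sum_(i < d) F (d * r + i)%N = \sum_(j < d * N) F j.
Proof.
elim: N => [|N IH]; first by rewrite muln0 !big_ord0.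
by rewrite big_ord_recr/= IH mulnSr big_split_ord.
Qed.

(** * Cuntz generators indexed with the last one singled out *)

Section CuntzGenerators.
Variables (R : realType) (n : nat) (hn : (1 < n)%N).
Variables (A : cstarAlgType R) (s : 'I_n -> A).
Hypothesis hA : is_cuntz_algebra s.
Local Notation C := R[i].

Definition gp_index (o : option 'I_n.-1) : 'I_n :=
  if o is Some i then low_ord i else last_ord hn.

Definition gp_gen o : A := s (gp_index o).

Lemma gp_index_inj : injective gp_index.
Proof.
move=> [i|] [j|] //= /(congr1 val) /= h.
- by congr Some; apply: val_inj.
- by have := ltn_ord i; rewrite h ltnn.
- by have := ltn_ord j; rewrite -h ltnn.
Qed.

Lemma gp_index_surj k : exists o, k = gp_index o.
Proof.
have [kn|kn] := ltnP k n.-1.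
  by exists (Some (Ordinal kn)); apply: val_inj.
exists None; apply: val_inj => /=; apply/eqP; rewrite eqn_leq kn andbT.
by rewrite -ltnS prednK ?ltn_ord// (ltn_trans _ hn).
Qed.

Lemma gp_gen_isom o o' : star (gp_gen o) * gp_gen o' = (o == o')%:R.
Proof. by have [[h _] _ _] := hA; rewrite h (inj_eq gp_index_inj). Qed.

Lemma gp_gen_sum :
  \sum_i gp_gen (Some i) * star (gp_gen (Some i)) +
  gp_gen None * star (gp_gen None) = 1.
Proof.
have [[_ <-] _ _] := hA; rewrite /gp_gen /=.
move: hn s; clear; case: n => // m hm s; rewrite big_ord_recr/=.
congr (_ + _).
  by apply: eq_bigr => i _; rewrite (_ : @low_ord m.+1 i = widen_ord (leqnSn m) i)//;
    exact: val_inj.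
by rewrite (_ : last_ord hm = ord_max)//; exact: val_inj.
Qed.

Lemma gp_gen_generates : forall S : set A, norm_closed S ->
  GRing.subalg_closed (mem S) -> (forall a, S a -> S (star a)) ->
  (forall o, S (gp_gen o)) -> S = setT.
Proof.
have [_ h _] := hA; move=> S S1 S2 S3 S4; apply: h => // k.
by have [p ->] := gp_index_surj k; exact: S4.
Qed.

Definition gp_equiv := progression_state_equiv gp_gen_isom gp_gen_sum
  gp_gen_generates.

Lemma pred_n_gt0 : (0 < n.-1)%N.
Proof. by case: n hn => [|[]]. Qed.

(** * Order infinity: sequences cut into rows of length n-1 *)

Section InfiniteOrder.

Definition block_seq (z : nat -> C) (r : nat) (i : 'I_n.-1) : C :=
  z (n.-1 * r + i)%N.

Lemma block_seq_unit z : l2_unit z -> unit_progression (block_seq z).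
Proof.
move=> /cvgrPdist_le hz e /hz [N _ hN]; exists N.
have := hN (n.-1 * N)%N (leq_pmull _ pred_n_gt0).
rewrite /sqr_sum /= seriesEord /block_seq.
rewrite (sum_blocks _ _ (fun j => normc (z j) ^+ 2)).
by rewrite ler_norml => /andP[_] /=; lra.
Qed.

Lemma block_seq_inj z y : (forall r i, block_seq z r i = block_seq y r i) -> z = y.
Proof.
move=> h; apply/funext => j.
have := h (j %/ n.-1)%N (Ordinal (ltn_pmod j pred_n_gt0)).
by rewrite /block_seq /= mulnC -divn_eq.
Qed.

Lemma gp_state_oo_equiv z y (wz wy : {scalar A}) : l2_unit z -> l2_unit y ->
  is_gp_state_oo hn s z wz -> is_gp_state_oo hn s y wy ->
  (state_equiv wz wy <-> z = y).
Proof.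
move=> uz uy [sz hz] [sy hy].
have E := gp_equiv sz sy hz hy (block_seq_unit uz) (block_seq_unit uy).
by split=> [/E/block_seq_inj//|zy]; apply/E; rewrite zy.
Qed.

End InfiniteOrder.

(** * Finite order, unrolled to infinite order *)

Section FiniteOrder.
Variables (k : nat) (hk : (0 < k)%N).
Implicit Types (z y : 'rV[C]_(n.-1 * k).+1) (w : {scalar A}).

(* A state of order [k] by [z] is also a state of infinite order: as [s_n^k]  *)
(* acts on the left as the scalar [conj z_m], its coordinates are those of    *)
(* [z] multiplied by the successive powers of [z_m].                          *)
Definition unroll z (r : nat) (i : 'I_n.-1) : C :=
  z 0 ord_max ^+ (r %/ k) * z 0 (inord (n.-1 * (r %% k) + i)).

Lemma in_W_sum z : in_W z ->
  \sum_(r < k) \sum_(i < n.-1) normc (z 0 (inord (n.-1 * r + i))) ^+ 2 =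
  1 - normc (z 0 ord_max) ^+ 2.
Proof.
move=> [h _]; have {}h : \sum_j normc (z 0 j) ^+ 2 = 1.
  apply: complexI; rewrite rmorph1 -h rmorph_sum.
  by apply: eq_bigr => j _; rewrite rmorphXn.
rewrite (sum_blocks _ _ (fun j => normc (z 0 (inord j)) ^+ 2)) -h big_ord_recr/=.
rewrite addrK; apply: eq_bigr => j _; congr (normc (z 0 _) ^+ 2).
by apply: val_inj; rewrite /= inordK// ltnS ltnW.
Qed.

Lemma in_W_lt1 z : in_W z -> normc (z 0 ord_max) < 1.
Proof. by move=> [_]; rewrite -ltcR. Qed.

(** Period p contributes x^(2p) (1 - x^2) with x = |z_m| < 1, so q periods of k rows sum to 1 -
    x^(2q). *)
Lemma unroll_unit z : in_W z -> unit_progression (unroll z).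
Proof.
move=> hz e e0; set x := normc (z 0 ord_max).
have x0 : 0 <= x by exact: normc_ge0.
have x1 : x < 1 by exact: in_W_lt1.
have [q hq] : exists q, (x ^+ 2) ^+ q <= e.
  by apply: exists_expr_le => //; rewrite sqr_ge0 expr_lt1.
exists (k * q)%N; rewrite /sqr_sum.
rewrite -(sum_blocks _ _ (fun r => \sum_i normc (unroll z r i) ^+ 2)).
rewrite [leRHS](_ : _ = 1 - (x ^+ 2) ^+ q); first by lra.
rewrite -opprB subrX1 -mulNr opprB mulr_sumr; apply: eq_bigr => p _.
rewrite -in_W_sum// mulr_suml; apply: eq_bigr => r _.
rewrite mulr_suml; apply: eq_bigr => i _.
rewrite /unroll (mulnC k p) divnMDl// divn_small// addn0 modnMDl modn_small//.
have normcX (a : C) m : normc (a ^+ m) = normc a ^+ m.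
  elim: m => [|m IH]; first by rewrite !expr0 ComplexField.Normc.normc1.
  by rewrite !exprS normc_mul IH.
by rewrite normc_mul normcX exprMn exprAC mulrC.
Qed.

(** Summing over the first k rows leaves w(t^k star(t^k)) <= |z_m|^2, so t^k is itself in the
    equality case and each full period pulls out a factor conj z_m. *)
Lemma unroll_state z w : in_W z -> is_gp_state hn s z w ->
  forall r i, w (gp_gen None ^+ r * gp_gen (Some i)) = Num.conj (unroll z r i).
Proof.
move=> hz [sw hw hwk].
have wt : Re (w (gp_gen None ^+ k * star (gp_gen None ^+ k))) <=
    normc (z 0 ord_max) ^+ 2.
  have := state_progression_sum gp_gen_sum sw k.
  suff : \sum_(r < k) \sum_(i < n.-1) normc (z 0 (inord (n.-1 * r + i))) ^+ 2 <=
     \sum_(r < k) \sum_i Re (w (gp_gen None ^+ r * gp_gen (Some i) *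
       star (gp_gen None ^+ r * gp_gen (Some i)))).
    by rewrite (in_W_sum hz); lra.
  apply: ler_sum => r _; apply: ler_sum => i _.
  exact: (state_ge_sqr sw (hw r i)).
have pull := state_eigen_mull sw hwk wt.
move=> r i; rewrite {1}(divn_eq r k) /unroll.
have rk : (r %% k < k)%N by rewrite ltn_mod.
elim: (r %/ k)%N => [|q IH].
  by rewrite mul0n add0n expr0 mul1r; exact: (hw (Ordinal rk) i).
by rewrite mulSn -addnA exprD -mulrA pull IH exprS -mulrA !conjCM.
Qed.

(** The first k rows are the coordinates other than z_m. If z_m differed from y_m, the next period
    would force these to vanish, whence |z_m| = 1, contradicting [in_W]. *)
Lemma unroll_inj z y : in_W z -> (forall r i, unroll z r i = unroll y r i) -> z = y.
Proof.
move=> hz h.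
have zy (r : 'I_k) (i : 'I_n.-1) :
    z 0 (inord (n.-1 * r + i)) = y 0 (inord (n.-1 * r + i)).
  by have := h r i; rewrite /unroll divn_small// modn_small// !expr0 !mul1r.
have zy_last : z 0 ord_max = y 0 ord_max.
  apply: contrapT => ne.
  have z0 (r : 'I_k) (i : 'I_n.-1) : z 0 (inord (n.-1 * r + i)) = 0.
    (* Row k + r compares z_m z_(r,i) with y_m z_(r,i). *)
    have := h (k + r)%N i; rewrite /unroll divnDl// divnn hk divn_small// addn0.
    rewrite modnDl modn_small// !expr1 -zy => /eqP.
    by rewrite -subr_eq0 -mulrBl mulf_eq0 subr_eq0 => /orP[/eqP//|/eqP].
  have := in_W_sum hz; rewrite big1 => [|r _]; last first.
    by rewrite big1// => i _; rewrite z0 ComplexField.Normc.normc0 expr0n.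
  move/eqP; rewrite eq_sym subr_eq0 => /eqP e1.
  have := in_W_lt1 hz; rewrite -(@expr_lt1 _ 2) ?normc_ge0//.
  by rewrite -e1 ltxx.
apply/rowP => j; have [jn|jn] := ltnP j (n.-1 * k); last first.
  suff -> : j = ord_max by [].
  by apply: val_inj; apply/eqP; rewrite /= eqn_leq jn andbT -ltnS ltn_ord.
have jk : (j %/ n.-1 < k)%N by rewrite ltn_divLR ?pred_n_gt0// (leq_trans jn)// mulnC.
have := zy (Ordinal jk) (Ordinal (ltn_pmod j pred_n_gt0)).
rewrite /= (mulnC n.-1 (j %/ n.-1)%N) -divn_eq (_ : inord j = j)//.
by apply: val_inj; rewrite /= inordK.
Qed.

Lemma gp_state_equiv z y (wz wy : {scalar A}) : in_W z -> in_W y ->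
  is_gp_state hn s z wz -> is_gp_state hn s y wy ->
  (state_equiv wz wy <-> z = y).
Proof.
move=> Wz Wy hz hy; have [sz _ _] := hz; have [sy _ _] := hy.
have E := gp_equiv sz sy (unroll_state Wz hz) (unroll_state Wy hy)
  (unroll_unit Wz) (unroll_unit Wy).
by split=> [/E/unroll_inj|zy]; [exact | apply/E; rewrite zy].
Qed.

End FiniteOrder.

End CuntzGenerators.

Theorem theorem1p8 (R : realType) (n : nat) (hn : (1 < n)%N)
    (A : cstarAlgType R) (s : 'I_n -> A) (hA : is_cuntz_algebra s) :
  (forall k : nat, (1 < k)%N ->
   forall z y : 'rV[R[i]]_(n.-1 * k).+1, in_W z -> in_W y ->
   forall wz wy : {scalar A},
     is_gp_state hn s z wz -> is_gp_state hn s y wy ->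
     (state_equiv wz wy <-> z = y)) /\
  (forall z y : nat -> R[i], l2_unit z -> l2_unit y ->
   forall wz wy : {scalar A},
     is_gp_state_oo hn s z wz -> is_gp_state_oo hn s y wy ->
     (state_equiv wz wy <-> z = y)).
Proof.
split=> [k k1 z y Wz Wy wz wy|z y uz uy wz wy].
  by apply: (gp_state_equiv hA) => //; exact: ltnW.
exact: (gp_state_oo_equiv hA).
Qed.
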